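(* Let $1\le p<\infty$ and let $\Omega\subset\mathbb{R}^{2d}$ be measurable with $0<|\Omega|<\infty$. Then $$\mathcal{B}_{\mathrm{wc}}(p,\Omega)\cap\mathcal{C}_{\mathrm{u}}^{\alpha}=\mathcal{K},$$ where $\mathcal{K}$ is the space of compact operators on $L^2(\mathbb{R}^d)$.
   Context: $\mathcal{B}$ is the space of bounded operators on the complex Hilbert space $L^2(\mathbb{R}^d)$ (inner product linear in the first entry). For $z=(x,\xi)\in\mathbb{R}^{2d}$, $\pi(z)f(y)=e^{2\pi i\xi\cdot y}f(y-x)$; for $S\in\mathcal{B}$, $\alpha_z(S)=\pi(z)S\pi(z)^*$ and $Q_Sf(z)=\langle\alpha_z(S)f,f\rangle$. Define $$\mathcal{B}_{\mathrm{wc}}(p,\Omega)=\{S\in\mathcal{B}: f_n\rightharpoonup f\text{ weakly in }L^2(\mathbb{R}^d)\implies\|Q_Sf_n\|_{L^p(\Omega)}\to\|Q_Sf\|_{L^p(\Omega)}\},$$ $$\mathcal{C}_{\mathrm{u}}^{\alpha}=\{S\in\mathcal{B}:\ \mathbb{R}^{2d}\ni z\mapsto\alpha_z(S)\in\mathcal{B}\text{ is continuous in operator norm}\}.$$ *)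

(* Defs.v *)
From HB Require Import structures.
From mathcomp Require Import all_boot all_order all_algebra.
From mathcomp Require Import all_classical all_reals all_analysis.
From mathcomp Require Import measurable_realfun complex.
Set Implicit Arguments.
Unset Strict Implicit.
Unset Printing Implicit Defensive.
Import Order.TTheory GRing.Theory Num.Theory.
Import numFieldNormedType.Exports.
Local Open Scope classical_set_scope.
Local Open Scope ring_scope.
Local Open Scope complex_scope.
Local Open Scope quotient_scope.

Local Notation re := (@complex.Re _).
Local Notation im := (@complex.Im _).
Local Notation modulus := (@Normc.normc _).

Section rV_measurable.
Context {R : realType}.
Variable n : nat.

(* The Borel sigma-algebra of R^n, generated by the coordinates. *)
Definition rV_measurable : set (set 'rV[R]_n) :=
  g_sigma_preimage (fun (i : 'I_n) (v : 'rV[R]_n) => v 0 i : measurableTypeR R).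

Let rV_set0 : rV_measurable set0.
Proof. exact: sigma_algebra0. Qed.

Let rV_setC A : rV_measurable A -> rV_measurable (~` A).
Proof. exact: sigma_algebraC. Qed.

Let rV_bigcup (F : (set 'rV[R]_n)^nat) :
  (forall i, rV_measurable (F i)) -> rV_measurable (\bigcup_i F i).
Proof. exact: sigma_algebra_bigcup. Qed.

Definition rV_display : measure_display.
Proof. by constructor. Qed.

HB.instance Definition _ := @isMeasurable.Build rV_display
  'rV[R]_n rV_measurable rV_set0 rV_setC rV_bigcup.
End rV_measurable.


Lemma measurable_coord (R : realType) n (i : 'I_n) :
  measurable_fun [set: 'rV[R]_n] (fun v => v 0 i : measurableTypeR R).
Proof.
move=> _ Y mY; rewrite setTI; apply: sub_sigma_algebra => /=.
rewrite -bigcup_seq/=; exists i => /=; first by rewrite mem_index_enum.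
by exists Y => //; rewrite setTI.
Qed.

Lemma measurable_fun_rVP d (T : measurableType d) (R : realType) n
    (f : T -> 'rV[R]_n) :
  (forall i, measurable_fun [set: T] (fun t => f t 0 i : measurableTypeR R)) ->
  measurable_fun [set: T] f.
Proof.
move=> mf _ A mA; rewrite setTI.
have : preimage_set_system [set: T] f measurable (f @^-1` A).
  by exists A => //; rewrite setTI.
rewrite -g_sigma_preimage_comp; apply: smallest_sub => //.
  exact: sigma_algebra_measurable.
rewrite -bigcup_seq => B [i _] [Y mY <-].
exact: mf.
Qed.

Section lebesgue_rV.
Local Open Scope ereal_scope.
Context {R : realType}.

Definition rV_cons n (p : measurableTypeR R * 'rV[R]_n) : 'rV[R]_n.+1 :=
  row_mx p.1%:M p.2 : 'rV[R]_(1 + n).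

Lemma measurable_rV_cons n : measurable_fun [set: _] (@rV_cons n).
Proof.
apply: measurable_fun_rVP => i; rewrite /rV_cons.
case: (@split_ordP 1 n i) => j ->.
  rewrite (_ : (fun _ => _) = fst); first exact: measurable_fst.
  by apply/funext => t; rewrite (row_mxEl t.1%:M t.2) [j]ord1 mxE.
rewrite (_ : (fun _ => _) = (fun v : 'rV[R]_n => v 0%R j : measurableTypeR R) \o snd).
  exact: (measurableT_comp (measurable_coord j) measurable_snd).
by apply/funext => t; rewrite (row_mxEr t.1%:M t.2).
Qed.

Definition rV_uncons n (v : 'rV[R]_n.+1) : measurableTypeR R * 'rV[R]_n :=
  (v 0%R 0%R, \row_j v 0%R (lift ord0 j)).

Lemma rV_consK n : cancel (@rV_cons n) (@rV_uncons n).
Proof.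
move=> [x v]; congr pair; rewrite /rV_cons /=.
  rewrite (_ : 0%R = lshift n ord0 :> 'I_(1 + n)); last exact/val_inj.
  by rewrite (row_mxEl x%:M v) mxE eqxx.
apply/rowP => j; rewrite mxE.
rewrite (_ : lift ord0 j = rshift 1 j :> 'I_(1 + n)); last exact/val_inj.
by rewrite (row_mxEr x%:M v).
Qed.

Lemma rV_unconsK n : cancel (@rV_uncons n) (@rV_cons n).
Proof.
move=> v; apply/rowP => i; rewrite /rV_cons; case: (@split_ordP 1 n i) => j ->.
  rewrite (row_mxEl (rV_uncons v).1%:M) [j]ord1 mxE eqxx /=; congr (v _ _).
  exact/val_inj.
rewrite (row_mxEr (rV_uncons v).1%:M) mxE; congr (v _ _); exact/val_inj.
Qed.

Lemma measurable_rV_uncons n : measurable_fun [set: _] (@rV_uncons n).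
Proof.
apply/measurable_fun_pairP; split; first exact: measurable_coord.
apply: measurable_fun_rVP => j /=.
under eq_fun do rewrite mxE.
exact: measurable_coord.
Qed.

Section step.
Variables (n : nat) (m : {sigma_finite_measure set 'rV[R]_n -> \bar R}).

Definition lebesgue_rV_step : set 'rV[R]_n.+1 -> \bar R :=
  pushforward (@lebesgue_measure R \x m) (@rV_cons n).

HB.instance Definition _ := Measure.copy lebesgue_rV_step
  (measure_function_pushforward__canonical__measure_function_Measure
     (@lebesgue_measure R \x m) (@measurable_rV_cons n)).

Let step_sigma_finite : sigma_finite setT lebesgue_rV_step.
Proof.
have /sigma_finiteP[F [TF ndF Foo]] := sigma_finiteT (@lebesgue_measure R).
have /sigma_finiteP[G [TG ndG Goo]] := sigma_finiteT m.
exists (fun k => @rV_uncons n @^-1` (F k `*` G k)).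
  rewrite -preimage_bigcup (_ : \bigcup_k _ = setT) ?preimage_setT//.
  apply/seteqP; split=> // -[x v] _.
  have [i _ Fix] : (\bigcup_k F k) x by rewrite -TF.
  have [j _ Gjv] : (\bigcup_k G k) v by rewrite -TG.
  exists (maxn i j) => //; split.
    by move: x Fix; exact/subsetPset/ndF/leq_maxl.
  by move: v Gjv; exact/subsetPset/ndG/leq_maxr.
move=> k; have [mF Fkoo] := Foo k; have [mG Gkoo] := Goo k; split.
  rewrite -[X in measurable X]setTI; apply: measurable_rV_uncons => //.
  exact: measurableX.
rewrite /lebesgue_rV_step /pushforward -comp_preimage.
rewrite (_ : _ \o _ = id); last by apply/funext => p; exact: rV_consK.
by rewrite preimage_id product_measure1E// lte_mul_pinfty// ge0_fin_numE.
Qed.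

HB.instance Definition _ :=
  Measure_isSigmaFinite.Build _ _ _ lebesgue_rV_step step_sigma_finite.
End step.

(* Lebesgue measure on the Borel sets of R^n, as the n-fold product of the
   one-dimensional one along the isomorphism R * R^n = R^(n+1). *)
Fixpoint lebesgue_rV n : {sigma_finite_measure set 'rV[R]_n -> \bar R} :=
  if n is n'.+1 then lebesgue_rV_step (lebesgue_rV n') else \d_(0%R : 'rV[R]_0).

End lebesgue_rV.

Section L2.
Context d (T : measurableType d) (R : realType).
Variable mu : {measure set T -> \bar R}.
Implicit Types f g : T -> R[i].

Definition complex_measurable f :=
  measurable_fun [set: T] (re \o f) /\
  measurable_fun [set: T] (im \o f).

Definition L2norm f : \bar R :=
  'N[mu]_2%:E [EFin \o (modulus \o f)]%E.

Definition square_integrable : {pred T -> R[i]} :=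
  [pred f | `[< complex_measurable f /\ (L2norm f < +oo)%E >]].

Lemma modulus_ge0 (z : R[i]) : 0 <= modulus z.
Proof. by case: z => a b; exact: sqrtr_ge0. Qed.

Lemma measurable_normc f : complex_measurable f ->
  measurable_fun [set: T] (modulus \o f).
Proof.
case=> mRe mIm.
rewrite (_ : _ \o _ =
    fun x => Num.sqrt ((re (f x)) ^+ 2 + (im (f x)) ^+ 2)).
  apply: measurableT_comp.
    by apply: continuous_measurable_fun; exact: sqrt_continuous.
  by apply: measurable_funD; apply: measurable_funX.
by apply/funext => x /=; case: (f x).
Qed.

Lemma complex_measurableD f g : complex_measurable f -> complex_measurable g ->
  complex_measurable (f + g).
Proof.
move=> [fR fI] [gR gI]; split.
  rewrite (_ : _ \o _ = (re \o f) \+ (re \o g)).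
    exact: measurable_funD.
  by apply/funext => x /=; rewrite /GRing.add /=; case: (f x) (g x) => [? ?] [].
rewrite (_ : _ \o _ = (im \o f) \+ (im \o g)).
  exact: measurable_funD.
by apply/funext => x /=; rewrite /GRing.add /=; case: (f x) (g x) => [? ?] [].
Qed.

Lemma complex_measurableM f g : complex_measurable f -> complex_measurable g ->
  complex_measurable (f \* g).
Proof.
move=> [fR fI] [gR gI]; split.
  rewrite (_ : _ \o _ = (re \o f) \* (re \o g) \-
                        (im \o f) \* (im \o g)).
    by apply: measurable_funB; exact: measurable_funM.
  by apply/funext => x /=; case: (f x) (g x) => [? ?] [].
rewrite (_ : _ \o _ = (re \o f) \* (im \o g) \+
                      (im \o f) \* (re \o g)).
  by apply: measurable_funD; exact: measurable_funM.
by apply/funext => x /=; case: (f x) (g x) => [? ?] [].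
Qed.

Lemma L2normD f g : complex_measurable f -> complex_measurable g ->
  (L2norm (f + g)%R <= L2norm f + L2norm g)%E.
Proof.
move=> cf cg; have mf := measurable_normc cf; have mg := measurable_normc cg.
rewrite /L2norm.
have mfg := measurable_normc (complex_measurableD cf cg).
apply: le_trans (minkowski_EFin mu mf mg (ler1n R 2)).
rewrite unlock gt0_ler_poweR ?in_itv/= ?leey ?integral_ge0 ?andbT//.
apply: ge0_le_integral => //.
- apply/measurable_EFinP; apply: (measurableT_comp (measurable_powR _)).
  exact: measurableT_comp.
- apply/measurable_EFinP; apply: (measurableT_comp (measurable_powR _)).
  by apply: measurableT_comp => //; exact: measurable_funD.
move=> x _; rewrite lee_fin ge0_ler_powR ?nnegrE ?normr_ge0//.
by rewrite !ger0_norm ?addr_ge0 ?modulus_ge0//; exact: le_normcD.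
Qed.

Lemma L2normZ (a : R[i]) f : complex_measurable f ->
  L2norm (a *: f) = ((modulus a)%:E * L2norm f)%E.
Proof.
move=> cf; rewrite /L2norm unlock.
under eq_integral => x _.
  rewrite /= Normc.normcM normrM powRM// EFinM.
  over.
rewrite ge0_integralZl//; last first.
  apply/measurable_EFinP; apply: (measurableT_comp (measurable_powR _)).
  by apply: measurableT_comp => //; exact: measurable_normc.
rewrite poweRM ?integral_ge0 ?lee_fin ?powR_ge0//.
by rewrite poweR_EFin -powRrM mulfV// powRr1// ger0_norm ?modulus_ge0.
Qed.

Lemma square_integrable_submod_closed : submod_closed square_integrable.
Proof.
split.
  apply/asboolP; split.
    by split; rewrite (_ : _ \o _ = cst 0).
  rewrite /L2norm (_ : _ \o _ = cst 0%E) ?Lnorm0//.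
  by apply/funext => x; congr EFin; exact: Normc.normc0.
move=> a f g /asboolP[mf foo] /asboolP[mg goo]; apply/asboolP.
have maf : complex_measurable (a *: f).
  by apply: (@complex_measurableM (cst a)) => //; split; exact: measurable_cst.
split; first exact: complex_measurableD.
rewrite (le_lt_trans (L2normD _ _))// lte_add_pinfty// L2normZ//.
by rewrite lte_mul_pinfty// lee_fin modulus_ge0.
Qed.

HB.instance Definition _ := GRing.isSubmodClosed.Build _ _ square_integrable
  square_integrable_submod_closed.

(* Representatives of the elements of L^2: every class of Lebesgue-measurable
   functions modulo a.e. equality contains a Borel one. *)
Record L2fun := MkL2fun {
  L2fun_val :> T -> R[i] ;
  _ : L2fun_val \in square_integrable }.

HB.instance Definition _ := [isSub for L2fun_val].
HB.instance Definition _ := [Choice of L2fun by <:].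
HB.instance Definition _ := [SubChoice_isSubLmodule of L2fun by <:].

Definition L2null : {pred L2fun} :=
  [pred f : L2fun | `[< {ae mu, forall x, f x = 0} >]].

Lemma L2null_zmod_closed : zmod_closed L2null.
Proof.
split; first by apply/asboolP; exact: nearW.
move=> f g /asboolP f0 /asboolP g0; apply/asboolP.
apply: filterS2 f0 g0 => x fx0 gx0.
by rewrite -[LHS]/(f x - g x) fx0 gx0 subr0.
Qed.

HB.instance Definition _ := GRing.isZmodClosed.Build _ L2null L2null_zmod_closed.

Definition L2 : Type := Quotient.quot L2null.

HB.instance Definition _ := Choice.on L2.
HB.instance Definition _ := EqQuotient.on L2.
HB.instance Definition _ := GRing.Zmodule.on L2.

Implicit Types u v : L2.

Lemma L2_piP (f g : L2fun) :
  \pi_L2 f = \pi_L2 g <-> {ae mu, forall x, f x = g x}.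
Proof.
have -> : \pi_L2 f = \pi_L2 g <-> f - g \in L2null.
  by rewrite Quotient.idealrBE; split=> /eqP.
split=> [/asboolP|] fg; last apply/asboolP; apply: filterS fg => x.
  by move=> /eqP; rewrite -[X in X == _]/(f x - g x) subr_eq0 => /eqP.
by move=> fgx; rewrite -[LHS]/(f x - g x) fgx subrr.
Qed.

Lemma L2_reprP (f : L2fun) : {ae mu, forall x, repr (\pi_L2 f) x = f x}.
Proof. by apply/L2_piP; rewrite reprK. Qed.

Lemma L2_piD (f g : L2fun) : \pi_L2 (f + g) = \pi_L2 f + \pi_L2 g.
Proof. exact: (raddfD (\pi_L2)). Qed.

Definition L2scale (a : R[i]) u : L2 := \pi_L2 (a *: repr u).

Lemma L2_piZ a (f : L2fun) : \pi_L2 (a *: f) = L2scale a (\pi_L2 f).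
Proof.
apply/L2_piP; apply: filterS (L2_reprP f) => x fx.
by rewrite -[LHS]/(a * f x) -fx.
Qed.

Let L2scaleA a b u : L2scale a (L2scale b u) = L2scale (a * b) u.
Proof. by elim/quotW: u => f; rewrite -(L2_piZ b) -!L2_piZ scalerA. Qed.

Let L2scale1 : left_id 1 L2scale.
Proof. by elim/quotW => f; rewrite -L2_piZ scale1r. Qed.

Let L2scaleDr : right_distributive L2scale +%R.
Proof.
move=> a; elim/quotW => f; elim/quotW => g.
by rewrite -L2_piD -!L2_piZ -L2_piD scalerDr.
Qed.

Let L2scaleDl u : {morph L2scale^~ u : a b / a + b}.
Proof.
by move=> a b; elim/quotW: u => f; rewrite -!L2_piZ -L2_piD scalerDl.
Qed.

HB.instance Definition _ := GRing.Zmodule_isLmodule.Build R[i] L2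
  L2scaleA L2scale1 L2scaleDr L2scaleDl.

Definition L2normC u : R[i] := (fine (L2norm (repr u)))%:C.

Lemma L2fun_measurable (f : L2fun) : complex_measurable f.
Proof. by case: f => f /= /asboolP[]. Qed.

Lemma L2fun_finite (f : L2fun) : L2norm f \is a fin_num.
Proof.
case: f => f /= /asboolP[_ foo].
by rewrite ge0_fin_numE// Lnorm_ge0.
Qed.

Lemma L2normC_pi (f : L2fun) : L2normC (\pi_L2 f) = (fine (L2norm f))%:C.
Proof.
congr (fine _)%:C; rewrite /L2norm unlock; congr poweR.
have mf (g : L2fun) :
    measurable_fun setT (fun x => (`|(EFin \o (modulus \o g)) x| `^ 2)%E).
  apply: (measurableT_comp (measurable_poweR _)) => //.
  apply: measurableT_comp => //; apply/measurable_EFinP.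
  by apply: measurable_normc; exact: L2fun_measurable.
apply: ge0_ae_eq_integral => //.
- by move=> x _; exact: poweR_ge0.
- by move=> x _; exact: poweR_ge0.
by apply: filterS (L2_reprP f) => x fx _ /=; rewrite fx.
Qed.

Let ler_L2normCD u v : L2normC (u + v) <= L2normC u + L2normC v.
Proof.
rewrite -[u]reprK -[v]reprK -L2_piD !L2normC_pi -rmorphD lecR.
rewrite -lee_fin EFinD !fineK ?L2fun_finite//.
by apply: L2normD; exact: L2fun_measurable.
Qed.

Let L2normCZ (a : R[i]) u : L2normC (a *: u) = `|a| * L2normC u.
Proof.
rewrite -[u]reprK -[a *: _]/(L2scale _ _) -L2_piZ !L2normC_pi.
rewrite L2normZ ?fineM ?L2fun_finite//; last exact: L2fun_measurable.
by rewrite rmorphM.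
Qed.

Let L2normC_eq0 u : L2normC u = 0 -> u = 0.
Proof.
elim/quotW: u => f; rewrite L2normC_pi => /complexI f0.
have {}f0 : L2norm f = 0%E by rewrite -(fineK (L2fun_finite f)) f0.
have mf := measurable_normc (L2fun_measurable f).
have /measurable_EFinP emf := mf.
have p0 : (0 < 2%:E :> \bar R)%E by rewrite lte_fin.
have /= f0ae := Lnorm_eq0_eq0 emf p0 f0.
rewrite -[RHS](raddf0 (\pi_L2)); apply/L2_piP.
by apply: filterS f0ae => x /(_ I) [] /Normc.eq0_normc.
Qed.

HB.instance Definition _ := Lmodule_isNormed.Build R[i] L2
  ler_L2normCD L2normCZ L2normC_eq0.

(* Linear in the first entry. *)
Definition L2dot u v : R[i] :=
  (\int[mu]_x re (repr u x * conjc (repr v x))) +i*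
  (\int[mu]_x im (repr u x * conjc (repr v x))).

(* The adjoint of a bounded operator is the only element of the set below; the
   default value 0 is only for maps that have no adjoint. *)
Definition adjoint (A : L2 -> L2) : L2 -> L2 :=
  xget (fun=> 0) [set B | forall u v, L2dot (A u) v = L2dot u (B v)].

End L2.

Section translation.
Context {R : realType}.
Local Notation leb := (@lebesgue_measure R).

Lemma measurable_shiftR (c : R) :
  measurable_fun [set: measurableTypeR R] (fun x => x - c : measurableTypeR R).
Proof. by apply: measurable_funB => //; exact: measurable_cst. Qed.

Lemma lebesgue_measure_shift (c : R) (A : set (measurableTypeR R)) :
  measurable A -> leb ((fun x => x - c) @^-1` A) = leb A.
Proof.
move=> mA; apply/esym.
pose m := measure_function_pushforward__canonical__measure_function_Measure
     leb (@measurable_shiftR c).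
apply: (@lebesgue_measure_unique R m) => // _ [[a b] _ <-].
rewrite /m /= /pushforward.
rewrite (_ : _ @^-1` _ = `](a + c), (b + c)]%classic); last first.
  by apply/seteqP; split=> x /=; rewrite !in_itv/= ltrBrDr lerBlDr.
by rewrite !lebesgue_measure_itv/= !lte_fin ltrD2r -!EFinB opprD addrACA subrr addr0.
Qed.

Lemma measurable_shift_rV n (x : 'rV[R]_n) :
  measurable_fun [set: 'rV[R]_n] (fun y => y - x).
Proof.
apply: measurable_fun_rVP => i; under eq_fun do rewrite !mxE.
by apply: measurable_funB; [exact: measurable_coord | exact: measurable_cst].
Qed.

Lemma lebesgue_rV_shift n (x : 'rV[R]_n) (A : set 'rV[R]_n) :
  measurable A -> lebesgue_rV n ((fun y => y - x) @^-1` A) = lebesgue_rV n A.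
Proof.
elim: n x A => [|n IHn] x A mA.
  rewrite (_ : _ @^-1` A = A)//; apply/funext => y /=.
  by rewrite [y - x]thinmx0 [y in RHS]thinmx0.
set B := @rV_cons R n @^-1` A.
have mB : measurable B.
  by rewrite -[B]setTI; exact: measurable_rV_cons.
pose x0 := (rV_uncons x).1; pose xs := (rV_uncons x).2.
have E : @rV_cons R n @^-1` ((fun y => y - x) @^-1` A) =
    (fun p => (p.1 - x0, p.2 - xs)) @^-1` B.
  apply/funext => p; rewrite /B /preimage /=; congr (A _).
  rewrite -[x in LHS]rV_unconsK; apply/rowP => i; rewrite !mxE.
  by case: (@fintype.split 1 n i) => j; rewrite !mxE -?mulrnBl.
transitivity (\int[leb]_s (lebesgue_rV n \o xsection B) (s - x0)%R)%E.
  rewrite /= /lebesgue_rV_step /pushforward E; apply: eq_integral => s _ /=.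
  rewrite -(IHn xs (xsection B (s - x0))); last exact: measurable_xsection.
  by congr (lebesgue_rV n _).
have mphi := measurable_fun_xsection (lebesgue_rV n) mB.
have := ge0_integral_pushforward (@measurable_shiftR x0) leb measurableT mphi.
rewrite preimage_setT => <- //.
apply: eq_measure_integral => [|? C mC _]; first exact: measurable_shiftR.
exact: lebesgue_measure_shift.
Qed.

Lemma ge0_integral_shift n (x : 'rV[R]_n) (g : 'rV[R]_n -> \bar R) :
  measurable_fun [set: 'rV[R]_n] g -> (forall y, 0 <= g y)%E ->
  (\int[lebesgue_rV n]_y g (y - x)%R = \int[lebesgue_rV n]_y g y)%E.
Proof.
move=> mg g0.
have := ge0_integral_pushforward (@measurable_shift_rV n x) (lebesgue_rV n)
  measurableT mg.
rewrite preimage_setT => <- //.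
apply: eq_measure_integral => [|? C mC _]; first exact: measurable_shift_rV.
exact: lebesgue_rV_shift.
Qed.

Lemma ae_shift n (x : 'rV[R]_n) (P : 'rV[R]_n -> Prop) :
  {ae lebesgue_rV n, forall y, P y} -> {ae lebesgue_rV n, forall y, P (y - x)}.
Proof.
case=> N [mN N0 PN]; exists ((fun y => y - x) @^-1` N); split.
- by rewrite -[X in measurable X]setTI; exact: measurable_shift_rV.
- by rewrite lebesgue_rV_shift.
- by move=> y; exact: PN.
Qed.

End translation.

Section operators.
Context (R : realType) (V : normedModType R[i]).

Definition bounded_operators : set {linear V -> V} :=
  [set S : {linear V -> V} | exists M : R, forall u, `|S u| <= M%:C * `|u|].

Definition compact_operators : set {linear V -> V} :=
  [set S : {linear V -> V} | compact (closure (S @` [set u | `|u| <= 1]))].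

Definition opnorm (A : V -> V) : \bar R :=
  ereal_sup [set (re `|A u|)%:E | u in [set u | `|u| <= 1]].

Definition weakly_converges (u_ : nat -> V) (u : V) : Prop :=
  forall phi : {linear V -> R[i]^o}, continuous phi ->
    phi (u_ n) @[n --> \oo] --> phi u.

End operators.
Arguments compact_operators {R} V _.

Section time_frequency.
Context (R : realType) (d : nat).
Local Notation mu := (@lebesgue_rV R d).
Local Notation H := (L2 mu).
(* (x, xi) in R^d * R^d = R^(2d) *)
Local Notation phase_space := ('rV[R]_d * 'rV[R]_d)%type.
Implicit Types (z : phase_space) (Omega : set phase_space).

Definition expi (t : R) : R[i] := cos t +i* sin t.

Definition tf_shift_fun z (f : 'rV[R]_d -> R[i]) : 'rV[R]_d -> R[i] :=
  fun y => expi (2 * pi * \sum_i z.2 0 i * y 0 i) * f (y - z.1).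

Lemma tf_shift_fun_square_integrable z (f : L2fun mu) :
  tf_shift_fun z f \in square_integrable mu.
Proof.
have /asboolP[[mRe mIm] foo] : (f : _ -> _) \in square_integrable mu by case: f.
have modE y : modulus (tf_shift_fun z f y) = modulus (f (y - z.1)).
  by rewrite Normc.normcM /expi/= cos2Dsin2 sqrtr1 mul1r.
apply/asboolP; split.
  apply: complex_measurableM.
    have mphase : measurable_fun [set: 'rV[R]_d]
        (fun y => 2 * pi * \sum_i z.2 0 i * y 0 i).
      apply: measurable_funM; first exact: measurable_cst.
      apply: measurable_sum => i; apply: measurable_funM => //.
      exact: measurable_coord.
    split.
      apply: (measurableT_comp _ mphase).
      exact: (continuous_measurable_fun (@continuous_cos R)).
    apply: (measurableT_comp _ mphase).
    exact: (continuous_measurable_fun (@continuous_sin R)).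
  by split; [apply: (measurableT_comp mRe) | apply: (measurableT_comp mIm)];
    exact: measurable_shift_rV.
rewrite (le_lt_trans _ foo)// /L2norm unlock.
under eq_integral do rewrite /= modE.
rewrite (@ge0_integral_shift R d z.1 (fun y => (`|modulus (f y)| `^ 2)%:E))//.
apply/measurable_EFinP; apply: (measurableT_comp (measurable_powR _)).
by apply: measurableT_comp => //; exact: measurable_normc.
Qed.

(* The time-frequency shift pi(z); it does not depend on the representative,
   see tf_shift_pi. *)
Definition tf_shift z (u : H) : H :=
  \pi_H (MkL2fun (tf_shift_fun_square_integrable z (repr u))).

Lemma tf_shift_pi z (f : L2fun mu) :
  tf_shift z (\pi_H f) = \pi_H (MkL2fun (tf_shift_fun_square_integrable z f)).
Proof.
apply/L2_piP; apply: filterS (ae_shift z.1 (L2_reprP f)) => y fy.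
by rewrite /= /tf_shift_fun fy.
Qed.

(* alpha_z(S) = pi(z) S pi(z)^* *)
Definition alpha z (S : H -> H) : H -> H :=
  fun u => tf_shift z (S (adjoint (tf_shift z) u)).

Definition Q (S : H -> H) (u : H) z : R[i] := L2dot (alpha z S u) u.

(* Lebesgue measure on R^(2d), on the Lebesgue-measurable sets: the completion
   of the Borel one. *)
Definition phase_measurable : set (set phase_space) :=
  (mu \x mu)%E^*%mu.-cara.-measurable.

Definition phase_measure :=
  @completed_measure_extension _ _ R (mu \x mu)%E.

Definition Lp_norm_on (p : R) Omega (F : phase_space -> R[i]) : \bar R :=
  ('N[phase_measure]_p%:E [(EFin \o (modulus \o F)) \_ Omega])%E.

Definition B_wc (p : R) Omega : set {linear H -> H} :=
  [set S : {linear H -> H} | bounded_operators S /\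
    forall (u_ : nat -> H) (u : H), weakly_converges u_ u ->
      Lp_norm_on p Omega (Q S (u_ n)) @[n --> \oo]
        --> Lp_norm_on p Omega (Q S u)].

Definition C_u_alpha : set {linear H -> H} :=
  [set S : {linear H -> H} | bounded_operators S /\
    forall z0, opnorm (alpha z S \- alpha z0 S) @[z --> z0] --> 0%E].

End time_frequency.

Arguments phase_measure {R d}.
Arguments C_u_alpha : clear implicits.

(* Main.v *)
(* Let [S] be compact and let [pi z] be the time-frequency shifts, which are
   unitary and strongly continuous. Finite nets of [S (ball)], together with the
   fact that [S] is small on vectors that are nearly orthogonal to a suitable
   finite set, turn strong continuity into norm continuity of [alpha z S]. If
   [u_n] tends weakly to [u], then it is bounded and [Q S u_n] tends to [Q S u]
   pointwise and boundedly, hence in [L^p] over the finite-measure set Omega.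

   Conversely, let [S] lie in both classes and let [v_n] be bounded and weakly
   null, so that the norm of [Q S v_n] over Omega tends to 0. Choose [z0] such
   that Omega has positive measure near [z0]. By norm continuity of [alpha z S],
   the functions [Q S v_n] vary little near [z0], uniformly in [n]; therefore
   [Q S v_n z0] tends to 0. With [v_n = pi z0 u_n] this says that the quadratic
   form of [S] tends to 0 along every bounded weakly null sequence, and by
   polarization [S u_n] tends to 0 in norm. Were [S] not compact, one could pick
   an orthonormal sequence along which [S] stays bounded below. *)
From HB Require Import structures.
Require Import Defs.
From mathcomp Require Import all_boot all_order all_algebra.
From mathcomp Require Import all_classical all_reals all_analysis.
From mathcomp Require Import measurable_realfun complex ring lra.
Import Order.TTheory GRing.Theory Num.Theory.
Import numFieldNormedType.Exports.
Set Implicit Arguments.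
Unset Strict Implicit.
Unset Printing Implicit Defensive.
Local Open Scope classical_set_scope.
Local Open Scope ring_scope.
Local Open Scope complex_scope.
Local Open Scope quotient_scope.

(** * Hilbert spaces and compact operators *)

(** Membership in [B_wc] controls only averages of [Q S u] over Omega, and an average says nothing
    about a single point; norm continuity of [alpha z S] converts averages into values. Its modulus
    of continuity depends only on a bound for the vectors, so one neighbourhood of [z0] serves a
    whole sequence. The same continuity makes the modulus of [Q S u] measurable, without which
    neither dominated convergence nor the Chebyshev bound could start; hence a compact operator is
    shown to lie in [C_u_alpha] before it is shown to lie in [B_wc].

    The general theory works with the real part of the inner product: a real symmetric form,
    preserved by multiplication by ['i], carries the complex structure while all estimates become
    real ones. Polarization then needs both the real and the imaginary part of the quadratic form.
    Compactness is used as total boundedness, by finite nets. Strong continuity of the shifts rests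
    on continuous bumps supported in boxes. *)

Definition rnorm (R : realType) (V : normedModType R[i]) (u : V) : R :=
  complex.Re `|u|.

Section rnorm.
Context {R : realType} {V : normedModType R[i]}.
Implicit Types u v : V.

Lemma normE u : `|u| = (rnorm u)%:C.
Proof. by rewrite RRe_real// normr_real. Qed.

Lemma rnorm_ge0 u : 0 <= rnorm u.
Proof. by rewrite -ler0c -normE. Qed.

Lemma rnormD u v : rnorm (u + v) <= rnorm u + rnorm v.
Proof. by rewrite -lecR rmorphD /= -!normE ler_normD. Qed.

Lemma rnormN u : rnorm (- u) = rnorm u.
Proof. by rewrite /rnorm normrN. Qed.

Lemma rnormBC u v : rnorm (u - v) = rnorm (v - u).
Proof. by rewrite -rnormN opprB. Qed.

Lemma rnormB u v : rnorm (u - v) <= rnorm u + rnorm v.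
Proof. by rewrite -(rnormN v) rnormD. Qed.

Lemma rnorm_triangle w u v : rnorm (u - v) <= rnorm (u - w) + rnorm (w - v).
Proof. by rewrite -[u - v](subrKA w) rnormD. Qed.

Lemma rnorm0 : rnorm (0 : V) = 0.
Proof. by rewrite /rnorm normr0. Qed.

Lemma rnorm_eq0 u : (rnorm u == 0) = (u == 0).
Proof. by rewrite -[RHS]normr_eq0 normE -(rmorph0 (real_complex R)) (inj_eq (@complexI R)). Qed.

Lemma rnormZ (a : R[i]) u : rnorm (a *: u) = Normc.normc a * rnorm u.
Proof.
by apply: complexI; rewrite -normE normrZ rmorphM /= -normE; congr (_ * _).
Qed.

Lemma rnormZR (a : R) u : rnorm (a%:C *: u) = `|a| * rnorm u.
Proof. by rewrite rnormZ /= expr0n addr0 sqrtr_sqr. Qed.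

Lemma rnormI u : rnorm ('i *: u) = rnorm u.
Proof. by rewrite rnormZ /= expr0n add0r expr1n sqrtr1 mul1r. Qed.

End rnorm.

(** [B] stands for the real part of the inner product. Since multiplication by ['i] preserves [B],
    the imaginary part is recovered as [B u ('i *: v)], so nothing of the complex structure is
    lost. *)
Record hilbert (R : realType) (V : normedModType R[i]) (B : V -> V -> R) : Prop :=
  Hilbert {
  hilbertC : forall u v, B u v = B v u ;
  hilbertDl : forall u v w, B (u + v) w = B u w + B v w ;
  hilbertZl : forall (a : R) u v, B (a%:C *: u) v = a * B u v ;
  hilbertI : forall u v, B ('i *: u) ('i *: v) = B u v ;
  hilbert_norm : forall u, B u u = rnorm u ^+ 2 ;
  hilbert_complete : forall u_ : nat -> V,
    (forall e : R, 0 < e -> exists N, forall m n, (N <= m)%N -> (N <= n)%N ->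
      rnorm (u_ m - u_ n) < e) ->
    exists u, rnorm (u_ n - u) @[n --> \oo] --> 0 }.

Section hilbert.
Context {R : realType} {V : normedModType R[i]} {B : V -> V -> R}.
Hypothesis hB : hilbert B.
Implicit Types u v w : V.

Let BC := hilbertC hB.
Let BDl := hilbertDl hB.
Let BZl := hilbertZl hB.
Let BN := hilbert_norm hB.

Lemma hilbertDr u v w : B u (v + w) = B u v + B u w.
Proof. by rewrite BC BDl BC [B w u]BC. Qed.

Lemma hilbertZr a u v : B u (a%:C *: v) = a * B u v.
Proof. by rewrite BC BZl BC. Qed.

Lemma hilbert0l u : B 0 u = 0.
Proof. by rewrite -(scale0r (0 : V)) -(rmorph0 (real_complex R)) BZl mul0r. Qed.

Lemma hilbertNl u v : B (- u) v = - B u v.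
Proof. by rewrite -scaleN1r -(rmorphN1 (real_complex R)) BZl mulN1r. Qed.

Lemma hilbertNr u v : B u (- v) = - B u v.
Proof. by rewrite BC hilbertNl BC. Qed.

Lemma hilbertBl u v w : B (u - v) w = B u w - B v w.
Proof. by rewrite BDl hilbertNl. Qed.

Lemma hilbertBr u v w : B u (v - w) = B u v - B u w.
Proof. by rewrite hilbertDr hilbertNr. Qed.

Lemma hilbert_suml I (r : seq I) (F : I -> V) v :
  B (\sum_(i <- r) F i) v = \sum_(i <- r) B (F i) v.
Proof.
by apply: (big_morph (B^~ v)) => [u w|]; [exact: BDl | exact: hilbert0l].
Qed.

Lemma sqr_rnormD u v : rnorm (u + v) ^+ 2 = rnorm u ^+ 2 + 2 * B u v + rnorm v ^+ 2.
Proof. by rewrite -!BN BDl !hilbertDr [B v u]BC; ring. Qed.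

Lemma sqr_rnormB u v : rnorm (u - v) ^+ 2 = rnorm u ^+ 2 - 2 * B u v + rnorm v ^+ 2.
Proof. by rewrite sqr_rnormD rnormN hilbertNr mulrN. Qed.

Lemma cauchy_schwarz u v : `|B u v| <= rnorm u * rnorm v.
Proof.
have [/eqP|v0] := eqVneq (rnorm v) 0.
  by rewrite rnorm_eq0 => /eqP->; rewrite BC hilbert0l normr0 mulr_ge0 ?rnorm_ge0.
have vp : 0 < rnorm v by rewrite lt_def v0 rnorm_ge0.
rewrite -ler_sqr ?nnegrE ?mulr_ge0 ?rnorm_ge0// real_normK ?num_real// exprMn.
(* The vector is the residual of projecting [u] on the real line through [v]. *)
have := sqr_ge0 (rnorm (u - (B u v / rnorm v ^+ 2)%:C *: v)).
rewrite sqr_rnormB hilbertZr rnormZR exprMn real_normK ?num_real//.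
have -> : rnorm u ^+ 2 - 2 * (B u v / rnorm v ^+ 2 * B u v) +
  (B u v / rnorm v ^+ 2) ^+ 2 * rnorm v ^+ 2 = rnorm u ^+ 2 - B u v ^+ 2 / rnorm v ^+ 2.
  by field.
by rewrite subr_ge0 ler_pdivrMr// exprn_gt0.
Qed.

Lemma hilbert_le u v : B u v <= rnorm u * rnorm v.
Proof. exact: le_trans (ler_norm _) (cauchy_schwarz u v). Qed.

(** A minimizing sequence is Cauchy by the parallelogram law. [W] is only a real subspace, which
    suits kernels of real-valued functionals; its closedness is given in approximation form. *)
Lemma hilbert_projection (W : set V) (u : V) :
  W 0 -> (forall v w, W v -> W w -> W (v + w)) ->
  (forall (a : R) v, W v -> W (a%:C *: v)) ->
  (forall v, (forall e : R, 0 < e -> exists2 w, W w & rnorm (v - w) < e) -> W v) ->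
  exists2 w, W w & forall v, W v -> B (u - w) v = 0.
Proof.
move=> W0 WD WZ Wcl.
pose D := [set rnorm (u - w) ^+ 2 | w in W].
have D0 : has_inf D.
  split; first by exists (rnorm (u - 0) ^+ 2), 0.
  by exists 0 => _ [w _ <-]; exact: sqr_ge0.
have infD w : W w -> inf D <= rnorm (u - w) ^+ 2.
  by move=> Ww; apply: ge_inf; [case: D0 | exists w].
have /choice[w_ w_P] : forall n, exists w, W w /\ rnorm (u - w) ^+ 2 < inf D + n.+1%:R^-1.
  move=> n; have n0 : 0 < n.+1%:R^-1 :> R by rewrite invr_gt0.
  by have [_ [w Ww <-] wlt] := inf_adherent n0 D0; exists w.
(* The midpoint of [w_ m] and [w_ n] lies in [W], so its squared distance to [u] is at least the
   infimum; the parallelogram law then bounds the difference. *)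
have near_inf m n : rnorm (w_ m - w_ n) ^+ 2 <= 2 * (m.+1%:R^-1 + n.+1%:R^-1).
  have [[Wm mP] [Wn nP]] := (w_P m, w_P n).
  have := infD _ (WZ 2^-1 _ (WD _ _ Wm Wn)).
  have -> : u - (2^-1)%:C *: (w_ m + w_ n) = (2^-1)%:C *: ((u - w_ m) + (u - w_ n)).
    rewrite addrACA -opprD scalerBr; congr (_ - _).
    rewrite -mulr2n -[u *+ 2]scaler_nat scalerA -[X in X = _]scale1r; congr (_ *: _).
    rewrite -(rmorph1 (real_complex R)) -(rmorph_nat (real_complex R)) -rmorphM /=.
    by congr (_%:C); field.
  rewrite rnormZR exprMn (sqr_rnormD (u - w_ m) (u - w_ n)).
  have -> : w_ m - w_ n = (u - w_ n) - (u - w_ m) by rewrite opprB [RHS]addrC addrA subrK.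
  rewrite (sqr_rnormB (u - w_ n)) ger0_norm// [B (u - w_ n) _]BC => H.
  move: mP nP H; move: (m.+1%:R^-1) (n.+1%:R^-1) (inf D) => a b d.
  by move: (rnorm _ ^+ 2) (rnorm _ ^+ 2) (B _ _) => x y z; lra.
have [|w cw] := @hilbert_complete _ _ _ hB w_.
  move=> e e0; have [N Ne] : exists N, N.+1%:R^-1 < e ^+ 2 / 4.
    have e2 : 0 < e ^+ 2 / 4 by rewrite divr_gt0// exprn_gt0.
    by have [N] := ltr_add_invr e2; rewrite add0r; exists N.
  exists N => m n Nm Nn.
  rewrite -ltr_sqr ?nnegrE ?rnorm_ge0 ?ltW//.
  apply: le_lt_trans (near_inf m n) _.
  have H k : (N <= k)%N -> k.+1%:R^-1 < e ^+ 2 / 4.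
    by move=> Nk; apply: le_lt_trans Ne; rewrite lef_pV2 ?posrE// ler_nat.
  by have := H _ Nm; have := H _ Nn; move: (m.+1%:R^-1) (n.+1%:R^-1) => a b; lra.
exists w.
  apply: Wcl => e e0; move/cvgrPdist_lt: cw => /(_ e e0)[N _ /(_ N (leqnn N))] /=.
  rewrite sub0r normrN ger0_norm ?rnorm_ge0// => we; exists (w_ N).
    by case: (w_P N).
  by rewrite rnormBC.
move=> v Wv.
(* Minimality at [w] compared with [w + t v]. The infimum is only approached along [w_], so the
   inequality is proved with an error [e]: half from [n.+1%:R^-1], half from replacing [w_ n] by
   [w]. *)
have key t : 2 * t * B (u - w) v <= t ^+ 2 * rnorm v ^+ 2.
  rewrite -subr_le0; apply/ler_addgt0Pr => e e0; rewrite add0r.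
  pose C := 1 + 2 * `|t| * rnorm v; have C0 : 0 < C.
    by rewrite ltr_wpDr// mulr_ge0 ?rnorm_ge0// mulr_ge0.
  have e2 : 0 < e / (2 * C) by rewrite divr_gt0// mulr_gt0.
  move/cvgrPdist_lt: cw => /(_ _ e2)[N _ cw].
  have [M Me] : exists M, M.+1%:R^-1 < e / 2.
    have eh : 0 < e / 2 by rewrite divr_gt0.
    by have [M] := ltr_add_invr eh; rewrite add0r; exists M.
  pose n := maxn N M.
  have {}cw : rnorm (w_ n - w) < e / (2 * C).
    have := cw n (leq_maxl _ _); rewrite /= sub0r normrN ger0_norm//.
    exact: rnorm_ge0.
  have {}Me : n.+1%:R^-1 < e / 2.
    by apply: le_lt_trans Me; rewrite lef_pV2 ?posrE// ler_nat ltnS leq_maxr.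
  have [Wn nP] := w_P n.
  have := infD _ (WD _ _ Wn (WZ t _ Wv)).
  rewrite opprD addrA sqr_rnormB hilbertZr rnormZR exprMn real_normK ?num_real//.
  have -> : B (u - w) v = B (u - w_ n) v + B (w_ n - w) v by rewrite -BDl subrKA.
  have : 2 * t * B (w_ n - w) v <= e / 2.
    apply: le_trans (ler_norm _) _.
    rewrite !normrM ger0_norm//.
    have t0 : 0 <= 2 * `|t| by rewrite mulr_ge0.
    apply: le_trans (ler_wpM2l t0 (cauchy_schwarz _ _)) _.
    have := ler_wpM2r (rnorm_ge0 v) (ltW cw); move=> /(ler_wpM2l (normr_ge0 t)) H.
    have -> : e / 2 = (e / (2 * C)) * C by field; rewrite gt_eqF.
    rewrite {2}/C; have := ltW e2; lra.
  move: nP Me; move: (n.+1%:R^-1) (inf D) => a d; clear.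
  move: (rnorm _ ^+ 2) (rnorm v ^+ 2) (B _ _) (B _ _) => x y z1 z2 H1 H2 H3 H4.
  lra.
(* The [+ 1] in this choice of [t] avoids a separate case for [v = 0]; the inequality becomes
   [(s + 2) * t ^+ 2 <= 0]. *)
have := key (B (u - w) v / (rnorm v ^+ 2 + 1)).
have N1 : 0 < rnorm v ^+ 2 + 1 by rewrite ltr_wpDl// sqr_ge0.
set b := B (u - w) v; set s := rnorm v ^+ 2; rewrite -/s in N1 *.
have -> : 2 * (b / (s + 1)) * b = 2 * (s + 1) * (b / (s + 1)) ^+ 2.
  by field; rewrite gt_eqF.
rewrite mulrC [_ ^+ 2 * s]mulrC => H.
have : (s + 2) * (b / (s + 1)) ^+ 2 <= 0 by lra.
rewrite pmulr_rle0; last by rewrite ltr_wpDl// sqr_ge0.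
rewrite le_eqVlt ltNge sqr_ge0 orbF sqrf_eq0 mulf_eq0 invr_eq0 (gt_eqF N1) orbF.
by move/eqP.
Qed.

(** If [phi] is not zero, the part [h] of some [u] orthogonal to the kernel spans the complement of
    the kernel; the scalar [phi h / rnorm h ^+ 2] is forced by testing on [h]. *)
Lemma riesz_representation (phi : V -> R) (C : R) :
  (forall u v, phi (u + v) = phi u + phi v) ->
  (forall (a : R) u, phi (a%:C *: u) = a * phi u) ->
  (forall u, `|phi u| <= C * rnorm u) ->
  exists w, forall u, phi u = B u w.
Proof.
move=> pD pZ pC.
have p0 : phi 0 = 0 by rewrite -(scale0r (0 : V)) -(rmorph0 (real_complex R)) pZ mul0r.
have pB u v : phi (u - v) = phi u - phi v.
  by rewrite pD -scaleN1r -(rmorphN1 (real_complex R)) pZ mulN1r.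
have [/(_ _) p_eq0|] := pselect (forall u, phi u = 0).
  by exists 0 => u; rewrite BC hilbert0l.
move=> /existsNP[u /eqP pu].
have [| | | |w pw wort] := @hilbert_projection [set u | phi u = 0] u.
- exact: p0.
- by move=> v w /= v0 w0; rewrite pD v0 w0 addr0.
- by move=> a v /= v0; rewrite pZ v0 mulr0.
- move=> v H /=; apply/eqP; rewrite -normr_le0; apply/ler_addgt0Pr => e e0.
  rewrite add0r.
  have e1 : 0 < e / (`|C| + 1) by rewrite divr_gt0// ltr_wpDl.
  have [w /= w0 wv] := H _ e1.
  rewrite -[phi v]subr0 -w0 -pB (le_trans (pC _))//.
  have := ler_wpM2l (normr_ge0 C) (ltW wv).
  have := ler_wpM2r (rnorm_ge0 (v - w)) (ler_norm C).
  have : `|C| * (e / (`|C| + 1)) <= e.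
    rewrite mulrCA -[leRHS]mulr1 ler_pM2l// ler_pdivrMr ?mul1r ?lerDl//.
  by move=> H1 /le_trans H2 H3; apply: H2 (le_trans H3 H1).
pose h := u - w.
have ph : phi h = phi u by rewrite pB pw subr0.
have h0 : rnorm h != 0.
  rewrite rnorm_eq0; apply: contra pu => /eqP h0.
  by rewrite -ph h0 p0.
exists ((phi h / rnorm h ^+ 2)%:C *: h) => v; rewrite hilbertZr.
have : phi (v - (phi v / phi h)%:C *: h) = 0.
  by rewrite pB pZ divfK ?subrr// ph.
move=> /wort; rewrite -/h BC hilbertBl BZl BN => /eqP; rewrite subr_eq0 => /eqP->.
by field; rewrite h0 ph pu.
Qed.

Lemma hilbertIl u v : B ('i *: u) v = - B u ('i *: v).
Proof.
rewrite -(hilbertI hB ('i *: u) v) scalerA -expr2 sqr_i scaleN1r.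
exact: hilbertNl.
Qed.

Lemma hilbertZCl (a : R[i]) u v :
  B (a *: u) v = complex.Re a * B u v - complex.Im a * B u ('i *: v).
Proof.
rewrite [a in LHS]complexE scalerDl (mulrC 'i) -scalerA BDl !BZl hilbertIl.
by rewrite mulrN.
Qed.

Lemma near_cvg0 (u_ : nat -> R) :
  u_ n @[n --> \oo] --> 0 <->
  forall e : R, 0 < e -> exists N, forall n, (N <= n)%N -> `|u_ n| < e.
Proof.
split=> [/cvgr0Pnorm_lt H e e0|H].
  by have [N _ HN] := H e e0; exists N => n /HN.
by apply/cvgr0Pnorm_lt => e e0; have [N HN] := H e e0; exists N.
Qed.

(** A continuous complex functional is determined by its real part, which the real Riesz theorem
    represents; conversely [B^~ v] is the real part of the continuous functional assembled from [v]
    and ['i *: v]. *)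
Lemma weakly_convergesP (u_ : nat -> V) u :
  weakly_converges u_ u <-> forall v, B (u_ n) v @[n --> \oo] --> B u v.
Proof.
split=> [wu v|wu phi cphi].
  pose f x : R[i]^o := B x v +i* B x ('i *: v).
  have lf : linear f.
    move=> a x y; rewrite /f !BDl !hilbertZCl scalerA -expr2 sqr_i scaleN1r.
    rewrite hilbertNr /=; case: a => a b /=.
    by congr (_ +i* _); rewrite /GRing.scale /=; ring.
  pose F : {linear V -> R[i]^o} := HB.pack f (GRing.isLinear.Build _ _ _ _ _ lf).
  have nF x : `|F x| <= (2 * rnorm v)%:C * `|x|.
    rewrite [`|x|]normE -rmorphM normc_def lecR.
    rewrite -[leRHS]ger0_norm ?mulr_ge0 ?rnorm_ge0// -sqrtr_sqr.
    rewrite ler_wsqrtr//=.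
    have := cauchy_schwarz x v; have := cauchy_schwarz x ('i *: v).
    rewrite rnormI !ler_norml => /andP[? ?] /andP[? ?].
    by have := rnorm_ge0 x; have := rnorm_ge0 v; nra.
  have cF : continuous F.
    apply/linear_bounded_continuous/linear_boundedP.
    exists (2 * rnorm v)%:C; split; first by rewrite complex_real.
    by move=> M /ltW leM x; apply: le_trans (nF x) _; rewrite ler_wpM2r.
  move/cvgrPdist_lt: (wu F cF) => FP; apply/cvgrPdist_lt => e e0.
  have := FP e%:C; rewrite ltcR => /(_ e0); apply: filterS => n.
  rewrite -linearB normc_def ltcR; apply: le_lt_trans => /=.
  by rewrite -hilbertBl -sqrtr_sqr ler_wsqrtr// lerDl sqr_ge0.
have /linear_bounded_continuous/linear_boundedP := cphi.
move=> [M [Mr phiM]].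
have {}phiM x : `|phi x| <= (complex.Re M + 1)%:C * `|x|.
  by apply: phiM; rewrite rmorphD /= RRe_real// ltrDl.
have [|||w wP] := @riesz_representation (fun x => complex.Re (phi x)) (complex.Re M + 1).
- by move=> x y; rewrite linearD; case: (phi x) (phi y) => [? ?] [].
- by move=> a x; rewrite linearZ /=; case: (phi x) => ? ? /=; rewrite mul0r subr0.
- move=> x; rewrite -lecR rmorphM /= -normE; apply: le_trans (phiM x).
  by rewrite normc_def lecR -sqrtr_sqr ler_wsqrtr// lerDl sqr_ge0.
(* The imaginary part of [phi x] is minus the real part of [phi ('i *: x)], so the vector
   representing the real part represents all of [phi]. *)
have phiE x : phi x = B x w +i* B x ('i *: w).
  rewrite -wP -[B x _]opprK -hilbertIl -wP linearZ /=.
  by case: (phi x) => a b /=; rewrite mul0r mul1r sub0r opprK.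
apply/cvgrPdist_lt => e; case: e => e1 e2; rewrite ltcE /= => /andP[/eqP-> e0].
have e2_gt0 : 0 < e1 / 2 by rewrite divr_gt0.
have /cvgrPdist_lt/(_ _ e2_gt0) H1 := wu w.
have /cvgrPdist_lt/(_ _ e2_gt0) H2 := wu ('i *: w).
apply: filterS2 H1 H2 => n; rewrite !phiE -!hilbertBl => H1 H2.
rewrite -[_ - _]/((B u w - B (u_ n) w) +i* (B u ('i *: w) - B (u_ n) ('i *: w))).
rewrite -!hilbertBl normc_def ltcR.
rewrite -[ltRHS]ger0_norm ?ltW// -sqrtr_sqr ltr_sqrt ?exprn_gt0//=.
by move: H1 H2; rewrite !ltr_norml => /andP[? ?] /andP[? ?]; nra.
Qed.

Lemma bounded_operatorsP (T : {linear V -> V}) :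
  bounded_operators T <-> exists2 M, 0 <= M & forall u, rnorm (T u) <= M * rnorm u.
Proof.
split=> [[M TM]|[M _ TM]]; last first.
  by exists M => u; rewrite !normE -rmorphM lecR.
exists `|M| => // u; apply: (@le_trans _ _ (M * rnorm u)).
  by rewrite -lecR rmorphM /= -!normE.
by rewrite ler_wpM2r ?rnorm_ge0 ?ler_norm.
Qed.

Lemma bounded_adjoint (T : {linear V -> V}) : bounded_operators T ->
  forall v, exists w, forall u, B (T u) v = B u w.
Proof.
move=> /bounded_operatorsP[M M0 TM] v.
apply: (@riesz_representation _ (M * rnorm v)).
- by move=> x y; rewrite linearD BDl.
- by move=> a x; rewrite linearZ BZl.
- move=> x; apply: le_trans (cauchy_schwarz _ _) _.
  by rewrite mulrAC ler_wpM2r ?rnorm_ge0.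
Qed.

Lemma closure_rnorm (A : set V) u : closure A u ->
  forall e : R, 0 < e -> exists2 v, A v & rnorm (u - v) < e.
Proof.
move=> Au e e0; have := Au (ball u e%:C).
case; first by apply: nbhsx_ballx; rewrite ltcR.
by move=> v [Av]; rewrite -ball_normE /= normE ltcR; exists v.
Qed.

(** Primeness of ultrafilters over finite unions; it selects a single ball out of a finite net. *)
Lemma ultrafilter_seq (U : Type) (I : choiceType) (F : set_system U) (s : seq I)
    (P : I -> set U) : UltraFilter F ->
  F [set x | exists2 i, i \in s & P i x] -> exists2 i, i \in s & F (P i).
Proof.
move=> FU; elim: s => [|i s IHs] FP.
  by have /filter_ex[x []] := FP.
have [FPi|FPi] := in_ultra_setVsetC (P i) FU; first by exists i; rewrite ?mem_head.
have [|j js FPj] := IHs; last by exists j; rewrite // in_cons js orbT.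
apply: filterS2 FP FPi => x [j]; rewrite in_cons => /orP[/eqP->//|js Pj _].
by exists j.
Qed.

(** Total boundedness in a complete space. For the converse, an ultrafilter on the closure contains
    a ball of every radius; any two of these meet, so the centres form a Cauchy sequence, whose
    limit is the limit of the ultrafilter. *)
Lemma precompactP (A : set V) : compact (closure A) <->
  forall e : R, 0 < e -> exists s : seq V, forall u, A u ->
    exists2 y, y \in s & rnorm (u - y) < e.
Proof.
split=> [cA e e0|netA].
  have e0' : 0 < e%:C by rewrite ltcR.
  move: cA; rewrite compact_cover => /(_ V setT (fun y => ball y e%:C)).
  case=> [y _|u _|s _ As]; first exact: ball_open.
    by exists u => //; exact: ballxx.
  exists (finmap.enum_fset s) => u /subset_closure/As[y /= ys]; rewrite -ball_normE /= normE ltcR.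
  by rewrite rnormBC; exists y.
rewrite compact_ultra => F FU FA.
have ballF (e : R) : 0 < e -> exists y, F [set u | rnorm (u - y) < e].
  move=> e0; have e20 : 0 < e / 2 by rewrite divr_gt0.
  have [s sP] := netA _ e20.
  have [|y ys Fy] := @ultrafilter_seq _ _ F s (fun y => [set u | rnorm (u - y) < e]) FU.
    apply: filterS FA => u Au; have [v /sP[y ys vy] uv] := closure_rnorm Au e20.
    exists y => //=; apply: le_lt_trans (rnorm_triangle v _ _) _.
    by rewrite [e]splitr ltrD.
  by exists y.
have /choice[x_ xP] : forall n, exists y, F [set u | rnorm (u - y) < n.+1%:R^-1].
  by move=> n; apply: ballF.
have xPN N n : (N <= n)%N -> F [set u | rnorm (u - x_ n) < N.+1%:R^-1].
  move=> Nn; apply: filterS (xP n) => u /= /lt_le_trans; apply.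
  by rewrite lef_pV2 ?posrE// ler_nat.
have smallN (e : R) : 0 < e -> exists N, N.+1%:R^-1 < e.
  by move=> e0; have [N] := ltr_add_invr e0; rewrite add0r; exists N.
have [e e0|x /near_cvg0 x_x] := hilbert_complete hB (u_ := x_).
  have [N Ne] : exists N, N.+1%:R^-1 < e / 2 by apply: smallN; rewrite divr_gt0.
  exists N => m n Nm Nn.
  have [u [/= um un]] : [set u | rnorm (u - x_ m) < N.+1%:R^-1] `&`
      [set u | rnorm (u - x_ n) < N.+1%:R^-1] !=set0.
    by apply: (@filter_ex _ F); apply: filterI; apply: xPN.
  apply: le_lt_trans (rnorm_triangle u _ _) _; rewrite rnormBC [e]splitr.
  by rewrite ltrD// (lt_trans _ Ne).
have Fx : F --> x.
  apply/fcvg_ballP => e e0; have e1 : 0 < complex.Re e / 2.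
    by move: e0; rewrite ltcE /= => /andP[_ e0]; rewrite divr_gt0.
  have [N Ne] := smallN _ e1; have [N' xe] := x_x _ e1.
  have Fn := xPN N (maxn N N') (leq_maxl _ _).
  apply: filterS Fn => u /= un.
  have -> : e = (complex.Re e)%:C by rewrite RRe_real// gtr0_real.
  rewrite -ball_normE /= normE ltcR rnormBC.
  apply: le_lt_trans (rnorm_triangle (x_ (maxn N N')) _ _) _.
  have := xe _ (leq_maxr N N'); rewrite ger0_norm ?rnorm_ge0// => xne.
  by rewrite [ltRHS]splitr ltrD// (lt_trans un).
exists x; split=> //; apply: closed_closure => C /Fx FC.
by apply: (@filter_ex _ F); apply: filterI.
Qed.

Lemma compact_operatorsP (T : {linear V -> V}) : compact_operators V T <->
  forall e : R, 0 < e -> exists s : seq V, forall u, rnorm u <= 1 ->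
    exists2 y, y \in s & rnorm (T u - y) < e.
Proof.
split=> [/precompactP H e /H[s sP]|H]; last apply/precompactP => e /H[s sP].
  exists s => u u1; apply: sP; exists u => //=.
  by rewrite normE -(rmorph1 (real_complex R)) lecR.
exists s => _ [u /= u1 <-]; apply: sP.
by rewrite -lecR -normE.
Qed.

Lemma compact_operator_bounded (T : {linear V -> V}) :
  compact_operators V T -> bounded_operators T.
Proof.
move=> /compact_operatorsP/(_ 1 ltr01)[s sP].
apply/bounded_operatorsP; pose M := \sum_(y <- s) rnorm y + 1.
have T1 u : rnorm u <= 1 -> rnorm (T u) <= M.
  move=> /sP[y ys Tuy]; rewrite -[T u](subrK y) (le_trans (rnormD _ _))//.
  rewrite /M [leRHS]addrC lerD//; first exact: ltW.
  rewrite (big_rem y)//= lerDl.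
  by apply: sumr_ge0 => *; exact: rnorm_ge0.
exists M; first by rewrite addr_ge0// sumr_ge0// => *; exact: rnorm_ge0.
move=> u; have [/eqP|u0] := eqVneq (rnorm u) 0.
  by rewrite rnorm_eq0 => /eqP->; rewrite linear0 !rnorm0 mulr0.
have up : 0 < rnorm u by rewrite lt_def u0 rnorm_ge0.
have := T1 ((rnorm u)^-1%:C *: u).
rewrite linearZ !rnormZR ger0_norm ?invr_ge0 ?rnorm_ge0// mulVf//.
by move=> /(_ (lexx _)); rewrite mulrC ler_pdivrMr.
Qed.

(* Pairing [T u] with a nearby point [y] of a finite net of [T(ball)] bounds
   [rnorm (T u) ^+ 2] by [M * e' + B u (T^* y)]. *)
Lemma compact_small (T : {linear V -> V}) (e : R) :
  compact_operators V T -> 0 < e -> exists2 del, 0 < del & exists s : seq V,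
    forall u, rnorm u <= 1 -> (forall y, y \in s -> `|B u y| <= del) ->
    rnorm (T u) <= e.
Proof.
move=> cT e0; have bT := compact_operator_bounded cT.
have /choice[Ts TsP] := bounded_adjoint bT.
have /bounded_operatorsP[M M0 TM] := bT.
have d0 : 0 < e ^+ 2 / 2 by rewrite divr_gt0// exprn_gt0.
have M1 : 0 < M + 1 by rewrite ltr_wpDl.
have /compact_operatorsP/(_ _ (divr_gt0 d0 M1))[s sP] := cT.
exists (e ^+ 2 / 2) => //; exists (map Ts s) => u u1 Bu.
have [y ys Tuy] := sP u u1.
rewrite -ler_sqr ?nnegrE ?rnorm_ge0 ?(ltW e0)// -BN -{2}[T u](subrK y) hilbertDr.
rewrite [leRHS]splitr lerD//.
  apply: le_trans (hilbert_le _ _) _.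
  have TuM : rnorm (T u) <= M + 1.
    by rewrite (le_trans (TM u))// (le_trans (ler_piMr M0 u1))// lerDl.
  apply: le_trans (ler_pM (rnorm_ge0 _) (rnorm_ge0 _) TuM (ltW Tuy)) _.
  by rewrite mulrC divfK// gt_eqF.
by rewrite TsP (le_trans (ler_norm _))// Bu// map_f.
Qed.
End hilbert.

(** * Compactness criteria and uniform boundedness *)

Section compactness_criterion.
Context {R : realType} {V : normedModType R[i]} {B : V -> V -> R}.
Hypothesis hB : hilbert B.
Implicit Types u v w : V.

Let BC := hilbertC hB.
Let BDl := hilbertDl hB.
Let BZl := hilbertZl hB.
Let BN := hilbert_norm hB.

(** Orthonormality is relative to the real form, so a vector and its multiple by ['i] may both
    occur. The absence of repetitions makes sums over [s] count each vector once. *)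
Definition orthonormal (s : seq V) :=
  uniq s /\ {in s &, forall x y, B x y = (x == y)%:R}.

Definition orthogonal_projection (s : seq V) u : V :=
  \sum_(y <- s) (B u y)%:C *: y.

Lemma orthogonal_projectionP s u y : orthonormal s -> y \in s ->
  B (orthogonal_projection s u) y = B u y.
Proof.
move=> [us os] ys; rewrite (hilbert_suml hB) (bigD1_seq y)//= big_seq_cond big1.
  by rewrite BZl addr0 (os y y)// eqxx mulr1.
by move=> x /andP[xs xy]; rewrite BZl (os x y)// (negbTE xy) mulr0.
Qed.

(** Pythagoras for [u] split into its projection and the remainder; the second bound keeps the
    remainder in the unit ball in [compact_of_small_complement]. *)
Lemma bessel s u : orthonormal s ->
  \sum_(y <- s) B u y ^+ 2 <= rnorm u ^+ 2 /\
  rnorm (u - orthogonal_projection s u) <= rnorm u.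
Proof.
move=> os; pose P := orthogonal_projection s u.
have uP : B u P = \sum_(y <- s) B u y ^+ 2.
  by rewrite BC (hilbert_suml hB); apply: eq_bigr => y _; rewrite BZl BC expr2.
have PP : rnorm P ^+ 2 = \sum_(y <- s) B u y ^+ 2.
  rewrite -BN {2}/P BC (hilbert_suml hB) big_seq [RHS]big_seq.
  by apply: eq_bigr => y ys; rewrite BZl [B y _]BC orthogonal_projectionP// expr2.
have := sqr_rnormB hB u P; rewrite uP PP => Pyth.
have S0 : 0 <= \sum_(y <- s) B u y ^+ 2 by apply: sumr_ge0 => y _; exact: sqr_ge0.
split; first by have := sqr_ge0 (rnorm (u - P)); lra.
by rewrite -ler_sqr ?nnegrE ?rnorm_ge0//; lra.
Qed.

(** The points [k%:R / m%:R - 1] with [k <= 2 * m] cut the interval from -1 to 1 into steps of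
    length [m%:R^-1]; the choice of [m] makes [a / m%:R < e], also when [a = 0]. *)
Lemma scalar_net (c a e : R) : 0 <= a -> 0 < e -> `|c| <= 1 ->
  let m := (Num.truncn (a / e)).+1 in
  exists2 k, k \in iota 0 (2 * m).+1 & `|c - (k%:R / m%:R - 1)| * a < e.
Proof.
move=> a0 e0 c1 m.
have m0 : 0 < m%:R :> R by rewrite ltr0n.
have c0 : 0 <= (c + 1) * m%:R.
  by move: c1; rewrite ler_norml => /andP[? ?]; rewrite mulr_ge0// -lerBlDr sub0r.
have /andP[k1 k2] := truncn_itv c0.
exists (Num.truncn ((c + 1) * m%:R)).
  rewrite mem_iota/= add0n ltnS -(ler_nat R) (le_trans k1)// natrM ler_wpM2r//.
  by move: c1; rewrite ler_norml => /andP[? ?]; lra.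
move: k1 k2; set k := Num.truncn _ => k1 k2.
have am : a < e * m%:R.
  by rewrite mulrC -ltr_pdivrMr// /m truncnS_gt.
have -> : c - (k%:R / m%:R - 1) = ((c + 1) * m%:R - k%:R) / m%:R.
  by field; rewrite gt_eqF.
rewrite ger0_norm ?divr_ge0 ?subr_ge0// mulrAC ltr_pdivrMr//.
apply: le_lt_trans am; rewrite ler_piMl//.
by move: k2; rewrite -natr1; lra.
Qed.

(** A bounded part of a finite-dimensional space is totally bounded: the coefficient of the head is
    rounded at cost [e / 2], the rest by induction at cost [e / 2]. *)
Lemma combination_net (I : eqType) (F : I -> V) (s : seq I) (e : R) : 0 < e ->
  exists t : seq V, forall c : I -> R, (forall i, `|c i| <= 1) ->
    exists2 z, z \in t & rnorm (\sum_(i <- s) (c i)%:C *: F i - z) < e.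
Proof.
elim: s e => [|i s IHs] e e0.
  exists [:: 0] => c _; exists 0; rewrite ?mem_head// big_nil subrr rnorm0//.
have e20 : 0 < e / 2 by rewrite divr_gt0.
have [t tP] := IHs _ e20.
pose m := (Num.truncn (rnorm (F i) / (e / 2))).+1.
exists [seq (k%:R / m%:R - 1 : R)%:C *: F i + z | k <- iota 0 (2 * m).+1, z <- t].
move=> c c1; have [z zt cz] := tP c c1.
have [k kiota ck] := scalar_net (rnorm_ge0 (F i)) e20 (c1 i).
exists ((k%:R / m%:R - 1 : R)%:C *: F i + z); first by apply/allpairsP; exists (k, z).
rewrite big_cons opprD addrACA -scalerBl (le_lt_trans (rnormD _ _))//.
by rewrite [e]splitr ltrD// -rmorphB rnormZR.
Qed.

(** On the unit ball [T] is within [e / 2] of the finite-rank operator that applies [T] to the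
    projection, and the image of the ball under the latter has a finite net. *)
Lemma compact_of_small_complement (T : {linear V -> V}) :
  bounded_operators T ->
  (forall e : R, 0 < e -> exists2 s, orthonormal s &
    forall u, (forall y, y \in s -> B u y = 0) -> rnorm (T u) <= e * rnorm u) ->
  compact_operators V T.
Proof.
move=> /(bounded_operatorsP)[M M0 TM] H; apply/(compact_operatorsP hB) => e e0.
have e20 : 0 < e / 2 by rewrite divr_gt0.
have [s os sP] := H _ e20.
have [t tP] := combination_net T s e20.
exists t => u u1.
(* [combination_net] bounds the coefficients at every index, so those outside [s] are set to 0;
   inside, Cauchy-Schwarz bounds them by 1. *)
have [|z zt uz] := tP (fun y => if y \in s then B u y else 0).
  move=> y; case: ifPn => [ys|_]; last by rewrite normr0.
  apply: le_trans (cauchy_schwarz hB _ _) _.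
  have : rnorm y ^+ 2 = 1 by rewrite -BN os.2// eqxx.
  move/eqP; rewrite sqrf_eq1 => /orP[/eqP->|/eqP y1]; first by rewrite mulr1.
  by have := rnorm_ge0 y; rewrite y1 oppr_ge0 ler10.
exists z => //.
have -> : T u - z = T (u - orthogonal_projection s u) +
    (\sum_(y <- s) (if y \in s then B u y else 0)%:C *: T y - z).
  rewrite linearB /= addrA; congr (_ - _).
  rewrite [X in _ - X](_ : _ = \sum_(y <- s) (if y \in s then B u y else 0)%:C *: T y).
    by rewrite subrK.
  rewrite linear_sum big_seq [RHS]big_seq; apply: eq_bigr => y ys.
  by rewrite ys linearZ.
apply: le_lt_trans (rnormD _ _) _; rewrite [e]splitr ler_ltD//.
apply: le_trans (sP _ _) _.
  by move=> y ys; rewrite (hilbertBl hB) orthogonal_projectionP// subrr.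
have [_ uPu] := bessel u os.
by rewrite -[leRHS]mulr1 ler_wpM2l ?(ltW e20)// (le_trans uPu).
Qed.

(** By Bessel the series of squares has bounded partial sums, so its terms tend to 0. *)
Lemma orthonormal_weak_null (e_ : nat -> V) v :
  (forall n, orthonormal (mkseq e_ n)) -> B (e_ n) v @[n --> \oo] --> 0.
Proof.
move=> oe.
have sE n : series (fun k => B v (e_ k) ^+ 2) n = \sum_(y <- mkseq e_ n) B v y ^+ 2.
  by rewrite /series /= big_map /index_iota subn0.
have : cvgn (series (fun k => B v (e_ k) ^+ 2)).
  apply: nondecreasing_is_cvgn.
    by apply: nondecreasing_series => n _ _; exact: sqr_ge0.
  exists (rnorm v ^+ 2) => _ [n _ <-]; rewrite sE.
  by have [] := bessel v (oe n).
move=> /cvg_series_cvg_0/near_cvg0 H; apply/near_cvg0 => e e0.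
have [N NP] := H _ (exprn_gt0 2 e0); exists N => n /NP.
by rewrite normrX ltr_sqr ?nnegrE ?normr_ge0 ?(ltW e0)// BC.
Qed.

(** Negating the condition of [compact_of_small_complement] supplies, for every finite orthonormal
    list, a further unit vector orthogonal to it whose image has norm at least [e]; a greedy choice
    gives the sequence. *)
Lemma compact_of_weak_null (T : {linear V -> V}) : bounded_operators T ->
  (forall e_ : nat -> V, (forall n, rnorm (e_ n) = 1) ->
    (forall v, B (e_ n) v @[n --> \oo] --> 0) ->
    rnorm (T (e_ n)) @[n --> \oo] --> 0) ->
  compact_operators V T.
Proof.
move=> bT H; apply: compact_of_small_complement => // e e0; apply: contrapT => Hno.
(* The implication sits under the existential so that choice yields a total function on lists; a
   list that is not orthonormal gets the junk value 0. *)
have step (s : seq V) : exists u, orthonormal s ->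
    [/\ rnorm u = 1, forall y, y \in s -> B u y = 0 & e <= rnorm (T u)].
  have [os|] := pselect (orthonormal s); last by exists 0.
  apply: contrapT => Hs; apply: Hno; exists s => // u us.
  rewrite leNgt; apply/negP => Tu; apply: Hs.
  have u0 : rnorm u != 0.
    apply/eqP => /eqP; rewrite rnorm_eq0 => /eqP u0.
    by move: Tu; rewrite u0 linear0 !rnorm0 mulr0 ltxx.
  have up : 0 < rnorm u by rewrite lt_def u0 rnorm_ge0.
  exists ((rnorm u)^-1%:C *: u) => _; split.
  - by rewrite rnormZR ger0_norm ?invr_ge0 ?rnorm_ge0// mulVf.
  - by move=> y ys; rewrite BZl us// mulr0.
  - rewrite linearZ rnormZR ger0_norm ?invr_ge0 ?rnorm_ge0// mulrC.
    by rewrite ler_pdivlMr// ltW.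
have [f fP] := choice step.
pose s_ := fix s n := if n is k.+1 then rcons (s k) (f (s k)) else [::].
pose e_ n := f (s_ n).
have sE n : mkseq e_ n = s_ n.
  by elim: n => // n IHn; rewrite mkseqS IHn.
have os n : orthonormal (s_ n).
  elim: n => [|n IHn]; first by split=> // ?.
  have [f1 fB _] := fP _ IHn.
  have ff : B (f (s_ n)) (f (s_ n)) = 1 by rewrite BN f1 expr1n.
  have fs : f (s_ n) \notin s_ n.
    by apply/negP => /fB /eqP; rewrite ff oner_eq0.
  split=> /=; first by rewrite rcons_uniq fs IHn.1.
  move=> x y; rewrite !mem_rcons !in_cons.
  move=> /predU1P[->|xs] /predU1P[->|ys].
  - by rewrite ff eqxx.
  - by rewrite fB//; case: eqP => // fy; move: fs; rewrite fy ys.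
  - by rewrite BC fB//; case: eqP => // fy; move: fs; rewrite -fy xs.
  - exact: IHn.2.
have /near_cvg0/(_ e e0)[N /(_ N (leqnn N))] : rnorm (T (e_ n)) @[n --> \oo] --> 0.
  apply: H => [n|v]; first by have [] := fP _ (os n).
  by apply: orthonormal_weak_null => n; rewrite sE.
by have [_ _ eT] := fP _ (os N); rewrite ltNge (le_trans eT)// ler_norm.
Qed.

(* Over the complex numbers, the quadratic form at [u - i T u] and its
   polarization recover [rnorm (T u) ^+ 2]. *)
Lemma compact_of_quadratic_form (T : {linear V -> V}) : bounded_operators T ->
  (forall (u_ : nat -> V) (M : R), (forall n, rnorm (u_ n) <= M) ->
    (forall v, B (u_ n) v @[n --> \oo] --> 0) ->
    B (T (u_ n)) (u_ n) @[n --> \oo] --> 0 /\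
    B (T (u_ n)) ('i *: u_ n) @[n --> \oo] --> 0) ->
  compact_operators V T.
Proof.
move=> bT H; apply: compact_of_weak_null => // e_ e1 we.
have /bounded_operatorsP[M M0 TM] := bT.
have TeM n : rnorm (T (e_ n)) <= M by rewrite (le_trans (TM _))// e1 mulr1.
have wTe v : B (T (e_ n)) v @[n --> \oo] --> 0.
  have [w wP] := bounded_adjoint hB bT v.
  by under eq_cvg do rewrite wP; exact: we.
pose g n := - ('i *: T (e_ n)).
have gM n : rnorm (g n) <= M by rewrite rnormN rnormI.
have wg v : B (g n) v @[n --> \oo] --> 0.
  under eq_cvg do rewrite /g (hilbertNl hB) (hilbertIl hB) opprK.
  exact: wTe.
have wD (x_ y_ : nat -> V) : (forall v, B (x_ n) v @[n --> \oo] --> 0) ->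
    (forall v, B (y_ n) v @[n --> \oo] --> 0) ->
    forall v, B (x_ n + y_ n) v @[n --> \oo] --> 0.
  move=> wx wy v; under eq_cvg do rewrite BDl.
  by have := cvgD (wx v) (wy v); rewrite addr0; exact.
have e1M n : rnorm (e_ n) <= 1 by rewrite e1.
have [H0 H1] := H _ _ e1M we.
have [_ H2] := H g M gM wg.
have [H3 _] := H (T \o e_) M TeM wTe.
have SM (h : nat -> V) : (forall n, rnorm (h n) <= M) -> forall n, rnorm (e_ n + h n) <= 1 + M.
  by move=> hM n; rewrite (le_trans (rnormD _ _))// lerD// e1.
have [_ H4] := H _ _ (SM g gM) (wD _ _ we wg).
have [H5 _] := H _ _ (SM (T \o e_) TeM) (wD _ (T \o e_) we wTe).
have ig n : 'i *: g n = T (e_ n).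
  by rewrite scalerN scalerA -expr2 sqr_i scaleN1r opprK.
(* The two differences leave the cross terms [rnorm (T (e_ n)) ^+ 2 + B (T (g n)) ('i *: e_ n)] and
   [rnorm (T (e_ n)) ^+ 2 + B (T (T (e_ n))) (e_ n)]; their second summands cancel because
   ['i *: g n = T (e_ n)]. *)
have E n : rnorm (T (e_ n)) ^+ 2 = 2^-1 *
    ((B (T (e_ n + g n)) ('i *: (e_ n + g n)) - B (T (e_ n)) ('i *: e_ n) -
      B (T (g n)) ('i *: g n)) +
     (B (T (e_ n + T (e_ n))) (e_ n + T (e_ n)) - B (T (e_ n)) (e_ n) -
      B (T (T (e_ n))) (T (e_ n)))).
  rewrite !(linearD T) /= scalerDr ig !BDl !(hilbertDr hB).
  have -> : B (T (T (e_ n))) (e_ n) = - B (T (g n)) ('i *: e_ n).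
    rewrite -{1}ig linearZ /= (hilbertIl hB).
    by [].
  by rewrite -!BN; field.
have : rnorm (T (e_ n)) ^+ 2 @[n --> \oo] --> 0.
  under eq_cvg do rewrite E.
  have := cvgM (@cvg_cst _ (2^-1 : R) _ \oo _) (cvgD (cvgB (cvgB H4 H1) H2) (cvgB (cvgB H5 H0) H3)).
  by rewrite !subr0 addr0 mulr0; exact.
move=> /near_cvg0 S; apply/near_cvg0 => e e0.
have [N NP] := S _ (exprn_gt0 2 e0); exists N => n /NP.
by rewrite normrX ltr_sqr ?nnegrE ?normr_ge0 ?(ltW e0).
Qed.

(* Sokal's proof of the uniform boundedness principle, for the functionals
   [B^~ (u_ n)]: choose signs so that the partial sums [x_k] of
   [\sum_k +- 3^-k u_(n k) / rnorm (u_(n k))] satisfy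
   [|B x_k (u_ (n k))| >= 3^-k rnorm (u_ (n k))]. *)
Lemma hilbert_uniform_boundedness (u_ : nat -> V) :
  (forall v, exists M : R, forall n, `|B (u_ n) v| <= M) ->
  exists M, forall n, rnorm (u_ n) <= M.
Proof.
move=> H; apply: contrapT => Hno.
have big M : exists n, M < rnorm (u_ n).
  apply: contrapT => HM; apply: Hno; exists M => n; rewrite leNgt.
  by apply/negP => Mn; apply: HM; exists n.
(* Growth [4 ^+ k] beats the step size [3 ^- k]: the contradiction comes from the lower bounds
   [(4 / 3) ^+ k / 2]. *)
have [n_ n_P] := choice (fun k => big (4 ^+ k)).
pose w k := u_ (n_ k).
have w4 k : 4 ^+ k < rnorm (w k) by exact: n_P.
have w0 k : 0 < rnorm (w k) by apply: lt_trans (w4 k); rewrite exprn_gt0.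
have step (p : nat * V) : exists y, rnorm (y - p.2) <= 3 ^- p.1 /\
    3 ^- p.1 * rnorm (w p.1) <= `|B (w p.1) y|.
  case: p => k x /=; pose h := (3 ^- k / rnorm (w k))%:C *: w k.
  have hN : rnorm h = 3 ^- k.
    rewrite rnormZR ger0_norm ?divr_ge0 ?rnorm_ge0 ?invr_ge0 ?exprn_ge0//.
    by rewrite divfK// gt_eqF.
  have hwk : B (w k) h = 3 ^- k * rnorm (w k).
    by rewrite (hilbertZr hB) BN -exprVn; field; rewrite gt_eqF ?w0.
  have [B0|B0] := leP 0 (B (w k) x).
    exists (x + h); rewrite addrAC subrr add0r hN; split => //.
    by rewrite (hilbertDr hB) hwk (le_trans _ (ler_norm _))// lerDr.
  exists (x - h); rewrite addrAC subrr add0r rnormN hN; split => //.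
  rewrite (hilbertBr hB) hwk distrC (le_trans _ (ler_norm _))//.
  by rewrite lerDl oppr_ge0 ltW.
have [f fP] := choice step.
pose x_ := fix x k := if k is j.+1 then f (j, x j) else 0.
have xS k : rnorm (x_ k.+1 - x_ k) <= 3 ^- k /\
    3 ^- k * rnorm (w k) <= `|B (w k) (x_ k.+1)|.
  exact: (fP (k, x_ k)).
(* The factor [3 / 2] sums the geometric series of ratio 1/3; keeping the subtracted term makes the
   induction close. *)
have tail k j : rnorm (x_ (k + j)%N - x_ k) <= 3 / 2 * (3 ^- k - 3 ^- (k + j)).
  elim: j => [|j IHj]; first by rewrite addn0 !subrr rnorm0 mulr0.
  rewrite addnS; apply: le_trans (rnorm_triangle (x_ (k + j)%N) _ _) _.
  have [xk _] := xS (k + j)%N.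
  apply: le_trans (lerD xk IHj) _.
  have -> : 3 ^- (k + j).+1 = 3 ^- (k + j) / 3 :> R by rewrite exprSr invfM.
  lra.
have tail' k j : rnorm (x_ (k + j)%N - x_ k) <= 3 / 2 * 3 ^- k.
  by apply: le_trans (tail k j) _; rewrite ler_wpM2l// lerBlDr lerDl invr_ge0 exprn_ge0.
have geo (q e : R) : 0 < q < 1 -> 0 < e -> exists N, q ^+ N < e.
  move=> /andP[q0 q1] e0.
  have /cvgr0Pnorm_lt/(_ e e0)[N _ /(_ N (leqnn N))] : q ^+ n @[n --> \oo] --> 0.
    by apply: cvg_expr; rewrite ger0_norm ?(ltW q0).
  by rewrite /= ger0_norm ?exprn_ge0 ?(ltW q0)//; exists N.
have small (e : R) : 0 < e -> exists N, 3 * 3 ^- N < e.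
  move=> e0; have e3 : 0 < e / 3 by rewrite divr_gt0.
  have q3 : 0 < (3^-1 : R) < 1 by rewrite invr_gt0 invf_lt1 ?ltr1n ?ltr0n.
  by have [N] := geo _ _ q3 e3; exists N; rewrite -exprVn mulrC -ltr_pdivlMr.
have [e e0|x /near_cvg0 xx] := hilbert_complete hB (u_ := x_).
  have [N Ne] := small e e0; exists N => m n Nm Nn.
  apply: le_lt_trans (rnorm_triangle (x_ N) _ _) _.
  rewrite [rnorm (x_ N - _)]rnormBC.
  by have := tail' N (m - N)%N; have := tail' N (n - N)%N; rewrite !subnKC//; lra.
(* All moves after [x_ k.+1] add up to at most half of [3 ^- k], so they undo at most half of what
   step [k] gained against [w k]. *)
have xk k : rnorm (x - x_ k.+1) <= 3 ^- k / 2.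
  apply/ler_addgt0Pr => e /xx[N xN].
  apply: le_trans (rnorm_triangle (x_ (k.+1 + N)%N) _ _) _.
  have := xN _ (leq_addl k.+1 N); rewrite ger0_norm ?rnorm_ge0// rnormBC => /ltW xe.
  rewrite addrC lerD// (le_trans (tail' _ _))//.
  by rewrite exprSr invfM; lra.
have [M MP] := H x.
have key k : (4 / 3) ^+ k / 2 <= M.
  apply: le_trans (MP (n_ k)); rewrite -/(w k).
  have [_ Bk] := xS k.
  have -> : x = (x - x_ k.+1) + x_ k.+1 by rewrite subrK.
  rewrite (hilbertDr hB) addrC.
  have := lerB_normD (B (w k) (x_ k.+1)) (B (w k) (x - x_ k.+1)).
  apply: le_trans.
  have := le_trans (cauchy_schwarz hB (w k) (x - x_ k.+1)) (ler_wpM2l (rnorm_ge0 _) (xk k)).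
  have : 0 <= 3 ^- k * (rnorm (w k) - 4 ^+ k).
    by rewrite mulr_ge0 ?invr_ge0 ?exprn_ge0// subr_ge0 ltW.
  rewrite exprMn -exprVn; rewrite -exprVn in Bk *.
  move: Bk; move: (3^-1 ^+ k) (`|_|) (`|_|) (rnorm _) (4 ^+ k) => a b c d f'.
  lra.
have q34 : 0 < (3 / 4 : R) < 1 by apply/andP; split; lra.
have M0 : 0 < M by apply: lt_le_trans (key 0%N); rewrite expr0; lra.
have [|N] := geo _ (2 * M)^-1 q34; first by rewrite invr_gt0 mulr_gt0.
rewrite -[3 / 4]invrK invf_div exprVn ltf_pV2 ?posrE ?exprn_gt0 ?mulr_gt0 ?divr_gt0//.
by have := key N; move: ((4 / 3) ^+ N) => a; lra.
Qed.

End compactness_criterion.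

(** * L^2 as a Hilbert space *)

Section L2_inner_product.
Context d (T : measurableType d) (R : realType).
Variable mu : {measure set T -> \bar R}.
Local Notation H := (L2 mu).
Implicit Types (f g : L2fun mu) (u v w : H).

(** The squared modulus as a polynomial, which keeps measurability and estimates free of square
    roots. *)
Definition sqmod (z : R[i]) : R := complex.Re z ^+ 2 + complex.Im z ^+ 2.

Lemma sqmod_ge0 z : 0 <= sqmod z.
Proof. by rewrite addr_ge0 ?sqr_ge0. Qed.

Lemma sqmodE z : sqmod z = Normc.normc z ^+ 2.
Proof. by case: z => a b; rewrite sqr_sqrtr// addr_ge0 ?sqr_ge0. Qed.

Lemma sqmod_le (z w : R[i]) : sqmod (z + w) <= 2 * sqmod z + 2 * sqmod w.
Proof.
case: z w => [a b] [a' b']; rewrite /sqmod /=.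
by have := sqr_ge0 (a - a'); have := sqr_ge0 (b - b'); nra.
Qed.

Lemma L2funDE f g x : (f + g : L2fun mu) x = f x + g x.
Proof. by []. Qed.

Lemma L2funBE f g x : (f - g : L2fun mu) x = f x - g x.
Proof. by []. Qed.

Lemma L2funZE (a : R[i]) f x : (a *: f : L2fun mu) x = a * f x.
Proof. by []. Qed.

Lemma measurable_sqmod (h : T -> R[i]) : complex_measurable h ->
  measurable_fun setT (fun x => sqmod (h x)).
Proof. by case=> mr mi; apply: measurable_funD; apply: measurable_funX. Qed.

Lemma L2norm_sqmod (h : T -> R[i]) :
  (L2norm mu h `^ 2 = \int[mu]_x (sqmod (h x))%:E)%E.
Proof.
rewrite /L2norm poweR_Lnorm ?pnatr_eq0//; apply: eq_integral => x _ /=.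
by rewrite ger0_norm ?modulus_ge0// powR_mulrn ?modulus_ge0// sqmodE.
Qed.

Lemma L2_sqmod f : (\int[mu]_x (sqmod (f x))%:E = (rnorm (\pi_H f) ^+ 2)%:E)%E.
Proof.
rewrite -L2norm_sqmod /rnorm -[`|_|]/(L2normC _) L2normC_pi /=.
rewrite -(fineK (L2fun_finite f)) poweR_EFin powR_mulrn//.
by rewrite fine_ge0// Lnorm_ge0.
Qed.

Lemma square_integrableP (h : T -> R[i]) : complex_measurable h ->
  (\int[mu]_x (sqmod (h x))%:E < +oo)%E -> h \in square_integrable mu.
Proof.
move=> mh; rewrite -L2norm_sqmod => hoo; apply/asboolP; split=> //.
by apply: lty_poweRy hoo; rewrite pnatr_eq0.
Qed.

Lemma integrable_sqmod f : mu.-integrable setT (fun x => (sqmod (f x))%:E).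
Proof.
apply/integrableP; split.
  by apply/measurable_EFinP/measurable_sqmod/L2fun_measurable.
under eq_integral do rewrite gee0_abs ?lee_fin ?sqmod_ge0//.
by rewrite L2_sqmod ltry.
Qed.

Lemma complex_measurable_conj (h : T -> R[i]) : complex_measurable h ->
  complex_measurable (fun x => conjc (h x)).
Proof.
move=> [mr mi]; split.
  by rewrite (_ : _ \o _ = @complex.Re R \o h)//; apply/funext => x /=; case: (h x).
rewrite (_ : _ \o _ = fun x => - (@complex.Im R \o h) x); first exact: measurable_funN.
by apply/funext => x /=; case: (h x).
Qed.

Let mdot f g : complex_measurable (fun x => f x * conjc (g x)).
Proof.
apply: complex_measurableM; first exact: L2fun_measurable.
exact/complex_measurable_conj/L2fun_measurable.
Qed.

Let dot_le (z w : R[i]) : `|complex.Re (z * conjc w)| <= sqmod z + sqmod w /\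
  `|complex.Im (z * conjc w)| <= sqmod z + sqmod w.
Proof.
case: z w => [a b] [a' b']; rewrite /sqmod /= !ler_norml.
have := sqr_ge0 (a - a'); have := sqr_ge0 (b - b').
have := sqr_ge0 (a + a'); have := sqr_ge0 (b + b').
have := sqr_ge0 (a - b'); have := sqr_ge0 (b - a').
have := sqr_ge0 (a + b'); have := sqr_ge0 (b + a').
by move=> *; split; apply/andP; split; nra.
Qed.

Let integrable_dominated f g (h : T -> R) : measurable_fun setT h ->
  (forall x, `|h x| <= sqmod (f x) + sqmod (g x)) ->
  mu.-integrable setT (EFin \o h).
Proof.
move=> mh hle.
apply: (le_integrable measurableT (f := EFin \o h)
  (g := fun x => (sqmod (f x))%:E + (sqmod (g x))%:E)%E) => //.
- exact/measurable_EFinP.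
- move=> x _ /=; rewrite lee_fin [leRHS]ger0_norm; first exact: hle.
  by rewrite addr_ge0 ?sqmod_ge0.
- exact: (integrableD measurableT (integrable_sqmod f) (integrable_sqmod g)).
Qed.

Lemma integrable_dot_re f g :
  mu.-integrable setT (EFin \o (fun x => complex.Re (f x * conjc (g x)))).
Proof.
apply: (integrable_dominated (f := f) (g := g)); first exact: (mdot f g).1.
by move=> x; have [] := dot_le (f x) (g x).
Qed.

Lemma integrable_dot_im f g :
  mu.-integrable setT (EFin \o (fun x => complex.Im (f x * conjc (g x)))).
Proof.
apply: (integrable_dominated (f := f) (g := g)); first exact: (mdot f g).2.
by move=> x; have [] := dot_le (f x) (g x).
Qed.

(** Independence of the representatives, which lets the identities below be checked pointwise on
    functions. *)
Lemma L2dot_pi f g : L2dot (\pi_H f) (\pi_H g) =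
  (\int[mu]_x complex.Re (f x * conjc (g x))) +i*
  (\int[mu]_x complex.Im (f x * conjc (g x))).
Proof.
have ff := L2_reprP f; have gg := L2_reprP g.
congr (_ +i* _); congr fine; apply: ae_eq_integral => //.
- exact: (measurable_int mu (integrable_dot_re (repr (\pi_H f)) (repr (\pi_H g)))).
- exact: (measurable_int mu (integrable_dot_re f g)).
- by apply: filterS2 ff gg => x fx gx _; rewrite fx gx.
- exact: (measurable_int mu (integrable_dot_im (repr (\pi_H f)) (repr (\pi_H g)))).
- exact: (measurable_int mu (integrable_dot_im f g)).
- by apply: filterS2 ff gg => x fx gx _; rewrite fx gx.
Qed.

Definition L2rdot u v : R := complex.Re (L2dot u v).

Lemma L2rdot_pi f g : L2rdot (\pi_H f) (\pi_H g) =
  \int[mu]_x complex.Re (f x * conjc (g x)).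
Proof. by rewrite /L2rdot L2dot_pi. Qed.

Lemma L2_scale_pi (a : R[i]) f : a *: \pi_H f = \pi_H (a *: f).
Proof. by rewrite L2_piZ. Qed.

Let L2rdotC u v : L2rdot u v = L2rdot v u.
Proof.
elim/quotW: u => f; elim/quotW: v => g; rewrite !L2rdot_pi.
apply: eq_Rintegral => x _; case: (f x) (g x) => [a b] [a' b'] /=; ring.
Qed.

Let L2rdotDl u v w : L2rdot (u + v) w = L2rdot u w + L2rdot v w.
Proof.
elim/quotW: u => f; elim/quotW: v => g; elim/quotW: w => h.
rewrite -L2_piD !L2rdot_pi -RintegralD//; try exact: integrable_dot_re.
apply: eq_Rintegral => x _.
rewrite L2funDE.
case: (f x) (g x) (h x) => [a b] [a' b'] [a'' b''] /=; ring.
Qed.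

Let L2rdotZl (a : R) u v : L2rdot (a%:C *: u) v = a * L2rdot u v.
Proof.
elim/quotW: u => f; elim/quotW: v => g.
rewrite L2_scale_pi !L2rdot_pi -RintegralZl//; last exact: integrable_dot_re.
apply: eq_Rintegral => x _.
rewrite L2funZE.
case: (f x) (g x) => [b c] [b' c'] /=; ring.
Qed.

Let L2rdotI u v : L2rdot ('i *: u) ('i *: v) = L2rdot u v.
Proof.
elim/quotW: u => f; elim/quotW: v => g.
rewrite !L2_scale_pi !L2rdot_pi; apply: eq_Rintegral => x _.
rewrite !L2funZE.
case: (f x) (g x) => [b c] [b' c'] /=; ring.
Qed.

Lemma L2dotE u v : L2dot u v = L2rdot u v +i* L2rdot u ('i *: v).
Proof.
elim/quotW: u => f; elim/quotW: v => g.
rewrite L2_scale_pi !L2rdot_pi L2dot_pi; congr (_ +i* _).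
apply: eq_Rintegral => x _; rewrite L2funZE.
case: (f x) (g x) => [b c] [b' c'] /=; ring.
Qed.

Let L2rdot_norm u : L2rdot u u = rnorm u ^+ 2.
Proof.
elim/quotW: u => f; rewrite L2rdot_pi; apply: EFin_inj.
rewrite -L2_sqmod fineK; last first.
  by apply: integrable_fin_num => //; exact: integrable_dot_re.
apply: eq_integral => x _; congr EFin; rewrite /sqmod.
by case: (f x) => a b /=; ring.
Qed.

Lemma cvg_geometric_increments (a : nat -> R) (C : R) :
  (forall k, `|a k.+1 - a k| <= C * (4^-1) ^+ k) -> cvgn a.
Proof.
move=> aC; have q1 : `|4^-1| < 1 :> R by rewrite ger0_norm ?invf_lt1 ?ltr1n ?ltr0n.
have C0 : 0 <= C by have := le_trans (normr_ge0 _) (aC 0%N); rewrite expr0 mulr1.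
have : cvgn (series (fun k => a k.+1 - a k)).
  apply: normed_cvg; apply: (series_le_cvg _ _ aC) => //=.
    by move=> n; rewrite mulr_ge0// exprn_ge0.
  exact: is_cvg_geometric_series.
have -> : series (fun k => a k.+1 - a k) = fun n => a n - a 0%N.
  by apply/funext => n; rewrite /series /= telescope_sumr.
move=> /(is_cvgD (is_cvg_cst (a 0%N))).
rewrite [X in cvgn X](_ : _ = a)//; apply/funext => n.
by rewrite /= -[LHS]/(a 0%N + (a n - a 0%N)) addrC subrK.
Qed.

(* For a subsequence with increments below [8^-k] in norm, the integral of
   [\sum_k 16^k |f (k+1) - f k|^2] is finite, so that almost everywhere the
   increments decay like [4^-k]; Fatou identifies the limit. *)
Lemma L2_complete (u_ : nat -> H) :
  (forall e : R, 0 < e -> exists N, forall m n, (N <= m)%N -> (N <= n)%N ->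
    rnorm (u_ m - u_ n) < e) ->
  exists u, rnorm (u_ n - u) @[n --> \oo] --> 0.
Proof.
move=> cu.
have /choice[N NP] : forall k, exists N, forall m n, (N <= m)%N -> (N <= n)%N ->
    rnorm (u_ m - u_ n) < 8^-1 ^+ k.
  by move=> k; apply: cu; rewrite exprn_gt0.
(* Summing the thresholds gives an index above all [N i] with [i <= k], and above [k] itself. *)
pose n_ k := (\sum_(i < k.+1) (N i).+1)%N.
have n_N i k : (i <= k)%N -> (N i <= n_ k)%N.
  move=> ik; rewrite /n_ (bigD1 (Ordinal (ik : (i < k.+1)%N)))//=.
  by rewrite -[leqLHS]addn0 leq_add.
have n_k k : (k <= n_ k)%N.
  apply: (@leq_trans (\sum_(i < k.+1) 1)%N); first by rewrite sum1_card card_ord.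
  exact: leq_sum.
pose f k : L2fun mu := repr (u_ (n_ k)).
have intB (g : L2fun mu) m : (\int[mu]_x (sqmod (g x - f m x))%:E =
    (rnorm (\pi_H g - u_ (n_ m)) ^+ 2)%:E)%E.
  under eq_integral do rewrite -L2funBE.
  by rewrite L2_sqmod raddfB /= reprK.
pose D k x := sqmod (f k.+1 x - f k x).
have mD k : measurable_fun setT (D k).
  exact: (measurable_sqmod (L2fun_measurable (f k.+1 - f k))).
have intD k : (\int[mu]_x (D k x)%:E <= ((64^-1) ^+ k)%:E)%E.
  rewrite /D intB reprK lee_fin.
  have -> : 64^-1 ^+ k = (8^-1 ^+ k) ^+ 2 :> R.
    by rewrite -exprM mulnC exprM expr2 -invfM -natrM.
  rewrite ler_sqr ?nnegrE ?rnorm_ge0 ?exprn_ge0// ltW// NP//; exact: n_N.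
(* The weight 16 is a compromise: the integrals stay summable, as [16 / 64 = 4^-1], while finiteness
   of [S x] forces [D k x] below a multiple of [16^-1 ^+ k], the square of the wanted rate. *)
pose S x := (\sum_(0 <= k <oo) (16 ^+ k * D k x)%:E)%E.
have SD_ge0 k x : (0 <= (16 ^+ k * D k x)%:E)%E.
  by rewrite lee_fin mulr_ge0 ?exprn_ge0 ?sqmod_ge0.
have mSD k : measurable_fun setT (fun x => (16 ^+ k * D k x)%:E).
  by apply/measurable_EFinP; apply: measurable_funM.
have intS : mu.-integrable setT S.
  apply/integrableP; split; first exact: ge0_emeasurable_sum.
  under eq_integral do rewrite gee0_abs ?nneseries_ge0//.
  rewrite integral_nneseries//; apply: (@le_lt_trans _ _ 2%:E); last exact: ltry.
  apply: lime_le; first by apply: is_cvg_nneseries => *; exact: integral_ge0.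
  apply: nearW => n; apply: (@le_trans _ _ (2 - 2 * 4^-1 ^+ n)%:E); last first.
    by rewrite lee_fin lerBlDr lerDl mulr_ge0// exprn_ge0.
  elim: n => [|n IHn]; first by rewrite big_geq// lee_fin expr0; lra.
  rewrite big_nat_recr//=; apply: le_trans (leeD IHn (_ : _ <= (4^-1 ^+ n)%:E)%E) _.
    under eq_integral do rewrite EFinM.
    rewrite ge0_integralZl//; last 2 first.
      exact/measurable_EFinP.
      by move=> x _; rewrite lee_fin sqmod_ge0.
    apply: le_trans (lee_wpmul2l _ (intD n)) _; first by rewrite lee_fin exprn_ge0.
    rewrite -EFinM lee_fin -exprMn.
    by have -> : 16 / 64 = 4^-1 :> R by field.
  rewrite -EFinD lee_fin exprSr.
  have : 0 <= 4^-1 ^+ n :> R by rewrite exprn_ge0.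
  by move: (4^-1 ^+ n) => a; lra.
have [N0 [mN0 muN0 N0P]] : {ae mu, forall x, S x \is a fin_num}.
  by have := integrable_ae measurableT intS; apply: filterS => x; exact.
have D_le x k : ~ N0 x -> D k x <= fine (S x) * 16^-1 ^+ k.
  move=> N0x; have Sx : S x \is a fin_num by apply: contrapT => /N0P.
  rewrite exprVn ler_pdivlMr ?exprn_gt0// mulrC -lee_fin fineK//.
  apply: le_trans (nneseries_lim_ge k.+1 _); last by move=> *; exact: SD_ge0.
  by rewrite big_nat_recr//= leeDr// sume_ge0.
have incr x k : ~ N0 x ->
    `|complex.Re (f k.+1 x) - complex.Re (f k x)| <= (fine (S x) + 1) * 4^-1 ^+ k /\
    `|complex.Im (f k.+1 x) - complex.Im (f k x)| <= (fine (S x) + 1) * 4^-1 ^+ k.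
  move=> N0x; have := D_le x k N0x; rewrite /D /sqmod.
  have s0 : 0 <= fine (S x) by rewrite fine_ge0// nneseries_ge0.
  have -> : 16^-1 = 4^-1 ^+ 2 :> R by field.
  rewrite -exprM mulnC exprM.
  have : 0 <= 4^-1 ^+ k :> R by rewrite exprn_ge0.
  move: (4^-1 ^+ k) (fine _) s0 => q s s0 q0.
  case: (f k.+1 x) (f k x) => [a b] [a' b'] /= H'.
  (* The square root of [s] is at most [s + 1], so no root has to be taken. *)
  have sq (y : R) : y ^+ 2 <= s * q ^+ 2 -> `|y| <= (s + 1) * q.
    move=> ys; rewrite -ler_sqr ?nnegrE ?normr_ge0 ?mulr_ge0 ?addr_ge0//.
    rewrite real_normK ?num_real// exprMn (le_trans ys)// ler_wpM2r ?sqr_ge0//.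
    by nra.
  have := sqr_ge0 (a - a'); have := sqr_ge0 (b - b').
  by move=> ? ?; split; apply: sq; lra.
(* Putting 0 on the exceptional null set makes the sequence converge everywhere, so that its limit
   is measurable. *)
pose F k x := (\1_(~` N0) x : R)%:C * f k x.
have FE k x : F k x = if x \in N0 then 0 else f k x.
  rewrite /F indicE in_setC; case: (x \in N0); first by rewrite mul0r.
  by rewrite mul1r.
have mF k : complex_measurable (F k).
  apply: complex_measurableM; last exact: L2fun_measurable.
  by split; [apply: measurable_indic; exact: measurableC | exact: measurable_cst].
have cF x : cvgn (fun k => complex.Re (F k x)) /\ cvgn (fun k => complex.Im (F k x)).
  have [xN|xN] := boolP (x \in N0).
    by split; under eq_fun do rewrite FE xN; exact: is_cvg_cst.
  have N0x : ~ N0 x by move=> /mem_set; rewrite (negbTE xN).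
  split; under eq_fun do rewrite FE (negbTE xN);
    by apply: (@cvg_geometric_increments _ (fine (S x) + 1)) => k; have [] := incr x k N0x.
pose fl x := (limn (fun k => complex.Re (F k x))) +i* (limn (fun k => complex.Im (F k x))).
have mfl : complex_measurable fl.
  split.
    apply: (@measurable_fun_cvg _ _ _ setT (fun k x => complex.Re (F k x))).
      by move=> k; have [] := mF k.
    by move=> x _; have [] := cF x.
  apply: (@measurable_fun_cvg _ _ _ setT (fun k x => complex.Im (F k x))).
    by move=> k; have [] := mF k.
  by move=> x _; have [] := cF x.
have fatou_fl (g : L2fun mu) (e : R) :
    (\forall k \near \oo, rnorm (\pi_H g - u_ (n_ k)) <= e) ->
    (\int[mu]_x (sqmod (g x - fl x))%:E <= (e ^+ 2)%:E)%E.
  move=> ge.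
  have mgF k : complex_measurable (fun x => g x - F k x).
    rewrite (_ : (fun x => _) = (g : T -> R[i]) + (cst (-1) \* F k)).
      apply: complex_measurableD; first exact: L2fun_measurable.
      by apply: complex_measurableM => //; split; exact: measurable_cst.
    by apply/funext => x; rewrite -[RHS]/(g x + -1 * F k x) mulN1r.
  have := @fatou _ _ _ mu setT measurableT (fun k x => (sqmod (g x - F k x))%:E).
  have lE x : limn_einf (fun k => (sqmod (g x - F k x))%:E) = (sqmod (g x - fl x))%:E.
    suff /cvg_limn_einf_sup[-> _] : (fun k => (sqmod (g x - F k x))%:E) @ \oo -->
      (sqmod (g x - fl x))%:E by [].
    apply/fine_cvgP; split; first exact: nearW.
    have [c1 c2] := cF x.
    rewrite (_ : sqmod _ =
        (complex.Re (g x) - limn (fun k => complex.Re (F k x))) ^+ 2 +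
        (complex.Im (g x) - limn (fun k => complex.Im (F k x))) ^+ 2); last first.
      by rewrite /sqmod /fl; case: (g x).
    rewrite (_ : fine \o _ = fun k => (complex.Re (g x) - complex.Re (F k x)) ^+ 2 +
        (complex.Im (g x) - complex.Im (F k x)) ^+ 2); last first.
      by apply/funext => k /=; rewrite /sqmod; case: (g x) (F k x) => [? ?] [].
    have c3 := cvgB (cvg_cst (complex.Re (g x))) c1.
    have c4 := cvgB (cvg_cst (complex.Im (g x))) c2.
    under eq_fun do rewrite !expr2.
    by rewrite !expr2; apply: cvgD; apply: cvgM; (exact: c3 || exact: c4).
  under eq_integral do rewrite lE.
  move=> /(_ _ _)/le_trans; apply.
  - by move=> k; apply/measurable_EFinP/measurable_sqmod/mgF.
  - by move=> k x _; rewrite lee_fin sqmod_ge0.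
  rewrite limn_einf_lim; apply: lime_le; first exact: is_cvg_einfs.
  case: ge => M _ MP; apply: nearW => n.
  apply: le_trans (ereal_inf_lbound _) _; first by exists (maxn n M); first exact: leq_maxl.
  rewrite (ae_eq_integral (fun x => (sqmod (g x - f (maxn n M) x))%:E))//.
  - rewrite intB lee_fin ler_sqr ?nnegrE ?rnorm_ge0//; last first.
      exact: le_trans (rnorm_ge0 _) (MP M (leqnn M)).
    by apply: MP; rewrite /= leq_maxr.
  - exact/measurable_EFinP/measurable_sqmod/mgF.
  - exact/measurable_EFinP/(measurable_sqmod (L2fun_measurable (g - f _))).
  - exists N0; split => // x /= /not_implyP[_].
    by rewrite FE; case: ifPn => // /set_mem.
have fl_near (e : R) : 0 < e -> exists M, forall n, (M <= n)%N ->
    (\int[mu]_x (sqmod (repr (u_ n) x - fl x))%:E <= (e ^+ 2)%:E)%E.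
  move=> /cu[M MP]; exists M => n Mn; apply: fatou_fl.
  exists M => // k /= Mk; rewrite reprK ltW// MP//.
  exact: leq_trans Mk (n_k k).
have fl2 : fl \in square_integrable mu.
  have [M /(_ M (leqnn M)) MP] := fl_near 1 ltr01.
  set g := repr (u_ M) in MP.
  have gin : (g : T -> R[i]) \in square_integrable mu by case: g {MP}.
  have mgfl : complex_measurable ((g : T -> R[i]) - fl).
    rewrite (_ : _ - fl = (g : T -> R[i]) + (cst (-1) \* fl)).
      apply: complex_measurableD; first exact: L2fun_measurable.
      by apply: complex_measurableM => //; split; exact: measurable_cst.
    by apply/funext => x; rewrite -[RHS]/(g x + -1 * fl x) mulN1r.
  rewrite -[fl](subKr (g : T -> R[i])) rpredB//.
  by apply: square_integrableP => //; apply: le_lt_trans MP _; rewrite ltry.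
exists (\pi_H (MkL2fun fl2)); apply/near_cvg0 => e e0.
have e20 : 0 < e / 2 by rewrite divr_gt0.
have [M MP] := fl_near _ e20; exists M => n /MP.
under eq_integral do rewrite -[fl _]/(MkL2fun fl2 _) -L2funBE.
rewrite L2_sqmod raddfB /= reprK lee_fin ler_sqr ?nnegrE ?rnorm_ge0 ?(ltW e20)// => ule.
by rewrite ger0_norm ?rnorm_ge0// (le_lt_trans ule)// ltr_pdivrMr// ltr_pMr// ltr1n.
Qed.

Lemma L2_hilbert : hilbert L2rdot.
Proof.
exact: (Hilbert L2rdotC L2rdotDl L2rdotZl L2rdotI L2rdot_norm L2_complete).
Qed.

End L2_inner_product.

(** * Time-frequency shifts *)

Section tf_shift.
Context (R : realType) (d : nat).
Local Notation mu := (@lebesgue_rV R d).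
Local Notation H := (L2 mu).
Local Notation phase_space := ('rV[R]_d * 'rV[R]_d)%type.
Local Notation B := (L2rdot (mu := mu)).
Implicit Types (u v : H) (z : phase_space) (f g : L2fun mu).

Let hB : hilbert B := L2_hilbert mu.

Lemma expiD (s t : R) : expi (s + t) = expi s * expi t.
Proof. by rewrite /expi cosD sinD; simpc; rewrite [X in _ +i* X]addrC [cos s * sin t]mulrC. Qed.

Lemma expi0 : expi (0 : R) = 1.
Proof. by rewrite /expi cos0 sin0. Qed.

Lemma normc_expi (t : R) : Normc.normc (expi t) = 1.
Proof. by rewrite /expi /= cos2Dsin2 sqrtr1. Qed.

Lemma sqmodM (z w : R[i]) : sqmod (z * w) = sqmod z * sqmod w.
Proof. by case: z w => [a b] [a' b']; rewrite /sqmod /=; ring. Qed.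

Lemma sqmod_expi (t : R) : sqmod (expi t) = 1.
Proof. by rewrite sqmodE normc_expi expr1n. Qed.

Lemma tf_shiftD z u v : tf_shift z (u + v) = tf_shift z u + tf_shift z v.
Proof.
elim/quotW: u => f; elim/quotW: v => g; rewrite -L2_piD !tf_shift_pi -L2_piD.
by apply/L2_piP; apply: nearW => y; rewrite L2funDE /= /tf_shift_fun -mulrDr.
Qed.

Lemma tf_shiftZ z (a : R[i]) u : tf_shift z (a *: u) = a *: tf_shift z u.
Proof.
elim/quotW: u => f; rewrite L2_scale_pi !tf_shift_pi L2_scale_pi.
by apply/L2_piP; apply: nearW => y; rewrite L2funZE /= /tf_shift_fun mulrCA.
Qed.

Lemma tf_shiftN z u : tf_shift z (- u) = - tf_shift z u.
Proof. by rewrite -scaleN1r tf_shiftZ scaleN1r. Qed.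

Lemma tf_shiftB z u v : tf_shift z (u - v) = tf_shift z u - tf_shift z v.
Proof. by rewrite tf_shiftD tf_shiftN. Qed.

Lemma rnorm_tf_shift z u : rnorm (tf_shift z u) = rnorm u.
Proof.
elim/quotW: u => f; rewrite tf_shift_pi.
apply/eqP; rewrite -(eqrXn2 (n := 2))// ?rnorm_ge0//; apply/eqP; apply: EFin_inj.
rewrite -!L2_sqmod /= /tf_shift_fun.
under eq_integral do rewrite sqmodM sqmod_expi mul1r.
rewrite (ge0_integral_shift z.1 (g := fun y => (sqmod (f y))%:E))//.
  by apply/measurable_EFinP/measurable_sqmod/L2fun_measurable.
by move=> y; rewrite lee_fin sqmod_ge0.
Qed.

(** Composing [tf_shift (- z)] with [tf_shift z] leaves a constant phase, of exponent 2 pi times the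
    scalar product of the two components of [z]; the scalar in front cancels it. *)
Definition tf_unshift z u : H :=
  expi (- (2 * pi * \sum_i z.2 0 i * z.1 0 i)) *: tf_shift (- z) u.

Lemma tf_shiftK z : cancel (tf_shift z) (tf_unshift z).
Proof.
move=> u; elim/quotW: u => f; rewrite (tf_shift_pi z f) /tf_unshift tf_shift_pi L2_scale_pi.
apply/L2_piP; apply: nearW => y; rewrite L2funZE /= /tf_shift_fun !mulrA -!expiD.
rewrite opprK addrK -!mulrN -!mulrDr.
rewrite -sumrN -!big_split /= big1 ?mulr0 ?expi0 ?mul1r// => i _.
by rewrite !mxE; ring.
Qed.

Lemma tf_unshiftK z : cancel (tf_unshift z) (tf_shift z).
Proof.
move=> u; elim/quotW: u => f; rewrite /tf_unshift tf_shiftZ (tf_shift_pi (- z) f) tf_shift_pi L2_scale_pi.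
apply/L2_piP; apply: nearW => y; rewrite L2funZE /= /tf_shift_fun !mulrA -!expiD.
rewrite opprK subrK -!mulrN -!mulrDr.
rewrite -sumrN -!big_split /= big1 ?mulr0 ?expi0 ?mul1r// => i _.
by rewrite !mxE; ring.
Qed.

Lemma rnorm_tf_unshift z u : rnorm (tf_unshift z u) = rnorm u.
Proof. by rewrite -[in RHS](tf_unshiftK z u) rnorm_tf_shift. Qed.

Lemma tf_unshiftD z u v : tf_unshift z (u + v) = tf_unshift z u + tf_unshift z v.
Proof. by rewrite /tf_unshift tf_shiftD scalerDr. Qed.

Lemma tf_unshiftZ z (a : R[i]) u : tf_unshift z (a *: u) = a *: tf_unshift z u.
Proof. by rewrite /tf_unshift tf_shiftZ !scalerA mulrC. Qed.

Lemma L2rdot_tf_shift z u v : B (tf_shift z u) (tf_shift z v) = B u v.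
Proof.
have := sqr_rnormD hB (tf_shift z u) (tf_shift z v).
by rewrite -tf_shiftD !rnorm_tf_shift (sqr_rnormD hB); lra.
Qed.

Lemma L2rdot_tf_unshift z u v : B (tf_unshift z u) v = B u (tf_shift z v).
Proof. by rewrite -(L2rdot_tf_shift z) tf_unshiftK. Qed.

Lemma L2dot_tf_shift z u v : L2dot (tf_shift z u) v = L2dot u (tf_unshift z v).
Proof.
have BC := hilbertC hB.
by rewrite !L2dotE -tf_unshiftZ !(BC u) !L2rdot_tf_unshift !(BC (tf_shift z u)).
Qed.

(** The default value of [adjoint] is excluded because [tf_unshift z] qualifies; the adjoint is
    unique because the form is definite. *)
Lemma adjoint_tf_shift z : adjoint (tf_shift z) = tf_unshift z.
Proof.
rewrite /adjoint; case: xgetP => [A _ /= AP|/(_ (tf_unshift z))]; last first.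
  by case; exact: L2dot_tf_shift.
apply/funext => v; apply/eqP; rewrite -subr_eq0 -rnorm_eq0 -sqrf_eq0.
rewrite -(hilbert_norm hB) (hilbertBr hB) subr_eq0; apply/eqP.
by rewrite /L2rdot -L2dot_tf_shift -AP.
Qed.

End tf_shift.

(** * Boxes in R^n and functions with vanishing integrals over boxes *)

Section box.
Context (R : realType) (n : nat).
Local Notation mu := (@lebesgue_rV R n).
Implicit Types (a b x y : 'rV[R]_n).

Definition box a b : set 'rV[R]_n := [set y | forall i, a 0 i < y 0 i < b 0 i].

Definition cube (N : nat) : set 'rV[R]_n := box (const_mx (- N%:R)) (const_mx N%:R).

Lemma measurable_box a b : measurable (box a b).
Proof.
have -> : box a b = \bigcap_(i in [set: 'I_n])
    ((fun y : 'rV[R]_n => y 0 i : measurableTypeR R) @^-1` `]a 0 i, b 0 i[%classic).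
  by apply/seteqP; split=> y /= yab i => [_|]; have := yab i; rewrite /= in_itv/=; [|apply].
apply: fin_bigcap_measurable => [|i _]; first exact: finite_finset.
by rewrite -[X in measurable X]setTI; exact: measurable_coord.
Qed.

Lemma box_setI a b a' b' : box a b `&` box a' b' =
  box (\row_i Num.max (a 0 i) (a' 0 i)) (\row_i Num.min (b 0 i) (b' 0 i)).
Proof.
apply/seteqP; split=> [y [yab yab'] i|y yab].
  by rewrite !mxE gt_max lt_min; have := yab i; have := yab' i => /andP[-> ->] /andP[-> ->].
by split=> i; have := yab i; rewrite !mxE gt_max lt_min => /andP[/andP[? ?] /andP[? ?]];
  apply/andP.
Qed.

Lemma cube_cover y : exists N0, forall N, (N0 <= N)%N -> cube N y.
Proof.
exists (Num.truncn (\sum_i `|y 0 i|)).+1 => N leN i; rewrite !mxE -ltr_norml.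
have leN' : (Num.truncn (\sum_i `|y 0 i|)).+1%:R <= N%:R :> R by rewrite ler_nat.
apply: lt_le_trans leN'; apply: le_lt_trans (truncnS_gt _).
by rewrite (bigD1 i)//= lerDl sumr_ge0.
Qed.

(** A coordinate half-space is the union of its intersections with the growing cubes, and each of
    these is a box. *)
Lemma rV_measurable_box :
  @measurable _ 'rV[R]_n = <<s [set A | exists a b, A = box a b] >>.
Proof.
set G := [set A | _].
apply/seteqP; split; last first.
  apply: smallest_sub; first exact: sigma_algebra_measurable.
  by move=> _ [a [b ->]]; exact: measurable_box.
apply: smallest_sub; first exact: smallest_sigma_algebra.
rewrite -bigcup_seq => A [i _] [Y mY <-]; rewrite setTI.
have : measurable_fun [set: g_sigma_algebraType G]
    (fun y : g_sigma_algebraType G => (y : 'rV[R]_n) 0 i : measurableTypeR R).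
  apply: (measurability _ (RGenOInfty.measurableE R)) => _ [_ [r ->] <-].
  rewrite setTI (_ : _ @^-1` _ = \bigcup_N
    box (\row_j if j == i then Num.max r (- N%:R) else - N%:R) (const_mx N%:R)).
    by apply: bigcup_measurable => N _; apply: sub_sigma_algebra; do 2 eexists.
  apply/seteqP; split=> [y /=|y [N _ yN]]; rewrite /= in_itv/= andbT.
    move=> ry; have [N NP] := cube_cover y; exists N => // j.
    have := NP N (leqnn N) j; rewrite !mxE; case: eqP => [->|//].
    by rewrite gt_max ry.
  by have := yN i; rewrite !mxE eqxx gt_max => /andP[/andP[]].
by move=> /(_ measurableT _ mY); rewrite setTI.
Qed.

(** A pi-lambda argument inside each cube: the sets [S] such that [h] integrates to 0 over the part
    of [S] in the cube form a Dynkin system containing the boxes. Cutting by the cube keeps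
    everything integrable. *)
Lemma ae_eq0_box (h : 'rV[R]_n -> R) : measurable_fun setT h ->
  (forall a b, mu.-integrable (box a b) (EFin \o h)) ->
  (forall a b, \int[mu]_(y in box a b) h y = 0) ->
  {ae mu, forall y, h y = 0}.
Proof.
move=> mh ih h0.
have mc N : measurable (cube N) by exact: measurable_box.
have intE A N : measurable A -> mu.-integrable (A `&` cube N) (EFin \o h).
  move=> mA; apply: (integrableS (mc N)) (ih _ _) => //; exact: measurableI.
have key N A : measurable A -> \int[mu]_(y in A `&` cube N) h y = 0.
  move=> mA.
  pose P S := \int[mu]_(y in S `&` cube N) h y = 0.
  have := @dynkin_induction _ 'rV[R]_n [set A | exists a b, A = box a b] P
    rV_measurable_box.
  rewrite -rV_measurable_box => dyn; apply: (dyn _ _ _ _ _ A mA) => {dyn A mA}.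
  - by move=> _ _ [a [b ->]] [a' [b' ->]]; rewrite box_setI; do 2 eexists.
  - by rewrite /P setTI; exact: h0.
  - by move=> _ [a [b ->]]; rewrite /P /cube box_setI; exact: h0.
  - move=> S mS; rewrite /P => S0.
    have := h0 (const_mx (- N%:R)) (const_mx N%:R); rewrite -/(cube N).
    rewrite -[X in \int[mu]_(y in X) _ = _](setTI (cube N)) -(setUv S) setIUl.
    rewrite Rintegral_setU ?S0 ?add0r//.
    + exact: measurableI.
    + by apply: measurableI => //; exact: measurableC.
    + by rewrite -setIUl; apply: intE; exact: measurableU (measurableC mS).
    + by apply/disj_setPS => y [[? _] []].
  - move=> F mF tF F0; rewrite /P setI_bigcupl /Rintegral integral_bigcup.
    + rewrite eseries0// => i _ _.
      rewrite -(@fineK _ (\int[mu]_(y in _) _)%E) -?[fine _]/(\int[mu]_(y in _) _) ?F0//.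
      by apply: integrable_fin_num; [exact: measurableI | exact: intE].
    + by apply: trivIset_setIr.
    + by move=> k; exact: measurableI.
    + by rewrite -setI_bigcupl; apply: intE; exact: bigcup_measurable.
have aeN N : {ae mu, forall y, cube N y -> h y = 0}.
  have /= : ae_eq mu (cube N) (EFin \o h) (cst 0%E).
    apply: integral_ae_eq => //; first exact: ih.
    move=> A AN mA; rewrite integral0.
    have := key N A mA; rewrite (setIidl AN) /Rintegral => A0.
    rewrite -(@fineK _ (\int[mu]_(y in _) _)%E) ?A0//.
    by apply: integrable_fin_num => //; apply: (integrableS (mc N)) (ih _ _).
  by apply: filterS => y Ny /Ny [].
have := ae_foralln aeN; apply: filterS => y hy.
by have [N NP] := cube_cover y; apply: (hy N); apply: NP.
Qed.

End box.

Lemma lebesgue_box_lty (R : realType) n (a b : 'rV[R]_n) :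
  (lebesgue_rV n (box a b) < +oo)%E.
Proof.
elim: n a b => [|n IHn] a b.
  by rewrite /= diracE; case: (_ \in _); rewrite ltry.
rewrite /= /lebesgue_rV_step /pushforward.
pose a' := (rV_uncons a).2; pose b' := (rV_uncons b).2.
rewrite (_ : _ @^-1` _ = `](a 0 0), (b 0 0)[%classic `*` box a' b').
  rewrite product_measure1E//; last exact: measurable_box.
  have ab_lty : (@lebesgue_measure R `](a 0%R 0%R), (b 0%R 0%R)[%classic < +oo)%E.
    by rewrite lebesgue_measure_itv/=; case: ifP => _; rewrite -?EFinB ltry.
  by apply: lte_mul_pinfty; [|rewrite ge0_fin_numE|exact: IHn].
have rV_cons0 s (v : 'rV[R]_n) : rV_cons (s, v) 0 0 = s.
  exact: (congr1 fst (rV_consK (s, v))).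
have rV_consS s (v : 'rV[R]_n) j : rV_cons (s, v) 0 (lift ord0 j) = v 0 j.
  by have /= := congr1 snd (rV_consK (s, v)) => /rowP/(_ j); rewrite mxE.
apply/seteqP; split=> -[s v] /=; rewrite in_itv/=.
  move=> sab; split; first by have := sab 0; rewrite rV_cons0.
  by move=> i; have := sab (lift ord0 i); rewrite rV_consS !mxE.
move=> [s0 vab] i; have [j ->|->] := unliftP ord0 i; last by rewrite rV_cons0.
by rewrite rV_consS; have := vab j; rewrite !mxE.
Qed.

(** * Strong continuity of the time-frequency shifts *)

Section strong_continuity.
Context (R : realType) (d : nat).
Local Notation mu := (@lebesgue_rV R d).
Local Notation H := (L2 mu).
Local Notation phase_space := ('rV[R]_d * 'rV[R]_d)%type.
Local Notation B := (L2rdot (mu := mu)).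
Implicit Types (u v : H) (z : phase_space) (a b x y : 'rV[R]_d).

Let hB : hilbert B := L2_hilbert mu.

Definition close_points (del : R) z z0 := forall i,
  `|z.1 0 i - z0.1 0 i| < del /\ `|z.2 0 i - z0.2 0 i| < del.

Lemma cvg_of_lt_inv (s_ : nat -> R) s :
  (forall n, `|s_ n - s| < n.+1%:R^-1) -> s_ n @[n --> \oo] --> s.
Proof.
move=> H; apply/cvgrPdist_lt => e e0.
have [N] := ltr_add_invr e0; rewrite add0r => Ne.
exists N => // n /= Nn; rewrite distrC (lt_trans (H n))// (le_lt_trans _ Ne)//.
by rewrite lef_pV2 ?posrE// ler_nat.
Qed.

(** The absolute value of a real plus that real is twice its positive part, so this is a continuous
    function, positive exactly on the box. *)
Definition box_slack a b y : R := \prod_i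
  ((`|y 0 i - a 0 i| + (y 0 i - a 0 i)) * (`|b 0 i - y 0 i| + (b 0 i - y 0 i))).

(** This is 1 - exp(-k s) with s the slack: continuous, zero off the box, and increasing to the
    indicator of the box as [k] grows. *)
Definition box_bump a b k y : R := 1 - expR (- box_slack a b y) ^+ k.

Let pos_part (t : R) : (0 < `|t| + t) = (0 < t) /\ 0 <= `|t| + t.
Proof.
have [t0|t0] := ltP 0 t; first by rewrite gtr0_norm// addr_gt0 ?addr_ge0 ?ltW.
by rewrite ler0_norm// addrC subrr ltxx.
Qed.

Lemma box_slack_ge0 a b y : 0 <= box_slack a b y.
Proof. by apply: prodr_ge0 => i _; rewrite mulr_ge0// (pos_part _).2. Qed.

Lemma box_slack_gt0 a b y : box a b y -> 0 < box_slack a b y.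
Proof.
move=> yab; apply: prodr_gt0 => i _.
by have /andP[? ?] := yab i; rewrite mulr_gt0// (pos_part _).1 subr_gt0.
Qed.

Lemma box_slack_eq0 a b y : ~ box a b y -> box_slack a b y = 0.
Proof.
move=> /existsNP[i /negP]; rewrite negb_and -!leNgt => yi.
rewrite /box_slack (bigD1 i)//=; apply/eqP; rewrite mulf_eq0 mulf_eq0.
apply/orP; left; case/orP: yi => yi; apply/orP; [left|right].
  by rewrite ler0_norm ?subr_le0// addrC subrr.
by rewrite ler0_norm ?subr_le0// addrC subrr.
Qed.

Let expR_slack a b y : 0 < expR (- box_slack a b y) <= 1.
Proof. by rewrite expR_gt0 /= -expR0 ler_expR oppr_le0 box_slack_ge0. Qed.

Lemma box_bump_ge0 a b k y : 0 <= box_bump a b k y.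
Proof.
have /andP[e0 e1] := expR_slack a b y.
by rewrite /box_bump subr_ge0 exprn_ile1// ltW.
Qed.

Lemma box_bump_le a b k y : box_bump a b k y <= \1_(box a b) y.
Proof.
have /andP[e0 e1] := expR_slack a b y.
rewrite indicE; case: (asboolP (box a b y)) => [yab|yab].
  by rewrite mem_set// /box_bump lerBlDr lerDl exprn_ge0// ltW.
by rewrite memNset// /box_bump box_slack_eq0// oppr0 expR0 expr1n subrr.
Qed.

Lemma measurable_box_bump a b k : measurable_fun setT (box_bump a b k).
Proof.
apply: measurable_funB => //; apply: measurable_funX.
apply: measurableT_comp => //; apply: measurableT_comp => //.
apply: measurable_prod => i _.
have mi := @measurable_coord R d i.
have m1 : measurable_fun setT (fun y : 'rV[R]_d => y 0 i - a 0 i).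
  by apply: measurable_funB => //; exact: mi.
have m2 : measurable_fun setT (fun y : 'rV[R]_d => b 0 i - y 0 i).
  by apply: measurable_funB => //; exact: mi.
by apply: measurable_funM; apply: measurable_funD => //; apply: measurableT_comp.
Qed.

Lemma cvg_box_bump a b k (y_ : nat -> 'rV[R]_d) y :
  (forall i, y_ n 0 i @[n --> \oo] --> y 0 i) ->
  box_bump a b k (y_ n) @[n --> \oo] --> box_bump a b k y.
Proof.
move=> yy; apply: cvgB; first exact: cvg_cst.
have cX : {for expR (- box_slack a b y), continuous (fun t : R => t ^+ k)}.
  exact: exprn_continuous.
apply: (cvg_comp (fun n => expR (- box_slack a b (y_ n))) (fun t : R => t ^+ k)) cX.
apply: (cvg_comp (fun n => - box_slack a b (y_ n)) expR); last exact: continuous_expR.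
apply: cvgN; rewrite /box_slack.
apply: cvg_big => [|i _]; first exact: mul_continuous.
have c1 : y_ n 0 i - a 0 i @[n --> \oo] --> y 0 i - a 0 i.
  by apply: cvgB; [exact: yy | exact: cvg_cst].
have c2 : b 0 i - y_ n 0 i @[n --> \oo] --> b 0 i - y 0 i.
  by apply: cvgB; [exact: cvg_cst | exact: yy].
by apply: cvgM; apply: cvgD; (exact: c1 || exact: c2 ||
  apply: cvg_norm; (exact: c1 || exact: c2)).
Qed.

Lemma box_bump_cvg1 a b y : box a b y -> box_bump a b k y @[k --> \oo] --> (1 : R).
Proof.
move=> yab; rewrite -[X in _ --> X]subr0; apply: cvgB; first exact: cvg_cst.
apply: cvg_expr; rewrite ger0_norm ?expR_ge0// -expR0 ltr_expR.
by rewrite oppr_lt0 box_slack_gt0.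
Qed.

Lemma integrable_indic_box a b (r : R) :
  mu.-integrable setT (fun y => (r * \1_(box a b) y)%:E).
Proof.
apply/integrableP; split.
  apply/measurable_EFinP; apply: measurable_funM => //.
  by apply: measurable_indic; exact: measurable_box.
rewrite (_ : (fun y => _) = fun y => (`|r|%:E * (\1_(box a b) y)%:E)%E); last first.
  by apply/funext => y; rewrite -EFinM /= normrM [X in _ * X]ger0_norm.
rewrite ge0_integralZl//.
- rewrite integral_indic//; last exact: measurable_box.
  by rewrite setIT lte_mul_pinfty// ?lee_fin ?lebesgue_box_lty.
- by apply/measurable_EFinP; apply: measurable_indic; exact: measurable_box.
Qed.

Lemma complex_measurable_bump a b k :
  complex_measurable (fun y => (box_bump a b k y)%:C).
Proof. by split; [exact: measurable_box_bump | exact: measurable_cst]. Qed.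

Lemma box_bump_square_integrable a b k :
  (fun y => (box_bump a b k y)%:C) \in square_integrable mu.
Proof.
apply: square_integrableP; first exact: complex_measurable_bump.
have /integrableP[_] := integrable_indic_box a b 1.
apply: le_lt_trans; apply: ge0_le_integral => //.
- by move=> y _; rewrite lee_fin sqmod_ge0.
- exact/measurable_EFinP/measurable_sqmod/complex_measurable_bump.
- have /integrableP[mi _] := integrable_indic_box a b 1.
  by apply: measurableT_comp.
- move=> y _ /=; rewrite lee_fin mul1r /sqmod /= [0 ^+ 2]expr0n addr0.
  have := box_bump_ge0 a b k y; have := box_bump_le a b k y; rewrite indicE.
  by case: (_ \in _) => /=; rewrite ?normr1 ?normr0; nra.
Qed.

Definition L2bump a b k : L2fun mu := MkL2fun (box_bump_square_integrable a b k).

Definition shift_continuous u := forall z0 (e : R), 0 < e ->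
  exists2 del, 0 < del & forall z, close_points del z z0 ->
    rnorm (tf_shift z u - tf_shift z0 u) < e.

Lemma sqmod_expi_sub (t s p q : R) : sqmod (expi t * p%:C - expi s * q%:C) =
  (cos t * p - cos s * q) ^+ 2 + (sin t * p - sin s * q) ^+ 2.
Proof. by rewrite /sqmod /= !mulr0 !subr0 !add0r. Qed.

(** Otherwise points [z_ n] tending to [z0] keep the distance at least [e], against dominated
    convergence: bumps are continuous and the translates in question all live in one box. *)
Lemma shift_continuous_bump a b k : shift_continuous (\pi_H (L2bump a b k)).
Proof.
move=> z0 e e0; apply: contrapT => Hno.
have step n : exists z, close_points n.+1%:R^-1 z z0 /\
    e <= rnorm (tf_shift z (\pi_H (L2bump a b k)) - tf_shift z0 (\pi_H (L2bump a b k))).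
  apply: contrapT => Hn; apply: Hno; exists n.+1%:R^-1; first by rewrite invr_gt0.
  move=> z zz0; rewrite ltNge; apply/negP => ez; apply: Hn; by exists z.
have [z_ zP] := choice step.
pose G n : L2fun mu := MkL2fun (tf_shift_fun_square_integrable (z_ n) (L2bump a b k)).
pose G0 : L2fun mu := MkL2fun (tf_shift_fun_square_integrable z0 (L2bump a b k)).
have intG n : (\int[mu]_y (sqmod (G n y - G0 y))%:E = (rnorm (tf_shift (z_ n)
    (\pi_H (L2bump a b k)) - tf_shift z0 (\pi_H (L2bump a b k))) ^+ 2)%:E)%E.
  under eq_integral do rewrite -L2funBE.
  by rewrite L2_sqmod raddfB /= !tf_shift_pi.
(* A margin of one unit on every side contains all the translates, since [z_ n] is within
   [n.+1%:R^-1 <= 1] of [z0]. *)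
pose a' := a + z0.1 - const_mx 1; pose b' := b + z0.1 + const_mx 1.
have bump_shift n y : box_bump a b k (y - (z_ n).1) <= \1_(box a' b') y.
  apply: le_trans (box_bump_le _ _ _ _) _; rewrite !indicE.
  case: (asboolP (box a b (y - (z_ n).1))) => [yab|yab]; last first.
    by rewrite memNset.
  rewrite mem_set// mem_set//= => i; have := yab i; rewrite !mxE.
  have [/(_ i)[+ _] _] := zP n.
  have : n.+1%:R^-1 <= 1 :> R by rewrite invf_le1// ler1n.
  move: (_^-1) => q q1; rewrite ltr_norml => /andP[? ?] /andP[? ?].
  by apply/andP; split; lra.
have bump_shift0 y : box_bump a b k (y - z0.1) <= \1_(box a' b') y.
  apply: le_trans (box_bump_le _ _ _ _) _; rewrite !indicE.
  case: (asboolP (box a b (y - z0.1))) => [yab|yab]; last by rewrite memNset.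
  rewrite mem_set// mem_set//= => i; have := yab i; rewrite !mxE.
  by move=> /andP[? ?]; apply/andP; split; lra.
have dom n y : sqmod (G n y - G0 y) <= 4 * \1_(box a' b') y.
  have bound (t s : R) : 0 <= s -> s <= \1_(box a' b') y ->
      sqmod (expi t * s%:C) <= \1_(box a' b') y.
    move=> s0 s1; rewrite sqmodM sqmod_expi mul1r /sqmod /= [0 ^+ 2]expr0n addr0.
    by move: s1; rewrite indicE; case: (_ \in _) => /=; nra.
  have sqN (w : R[i]) : sqmod (- w) = sqmod w by case: w => p q; rewrite /sqmod /= !sqrrN.
  apply: le_trans (sqmod_le _ _) _; rewrite sqN.
  rewrite (_ : 4 * _ = 2 * \1_(box a' b') y + 2 * \1_(box a' b') y).
    apply: lerD; rewrite ler_wpM2l//; apply: bound => //; exact: box_bump_ge0.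
  by rewrite -mulrDl -natrD.
have Gcvg y : (sqmod (G n y - G0 y))%:E @[n --> \oo] --> 0%E.
  apply/fine_cvgP; split; first exact: nearW.
  pose th n := 2 * pi * \sum_i (z_ n).2 0 i * y 0 i.
  pose th0 := 2 * pi * \sum_i z0.2 0 i * y 0 i.
  have cth : th n @[n --> \oo] --> th0.
    apply: cvgM; first exact: cvg_cst.
    apply: cvg_big => [|i _]; first exact: add_continuous.
    apply: cvgM; last exact: cvg_cst.
    by apply: cvg_of_lt_inv => n; have [/(_ i)[]] := zP n.
  have cb : box_bump a b k (y - (z_ n).1) @[n --> \oo] --> box_bump a b k (y - z0.1).
    apply: cvg_box_bump => i; rewrite !mxE; under eq_fun do rewrite !mxE.
    apply: cvgB; first exact: cvg_cst.
    by apply: cvg_of_lt_inv => n; have [/(_ i)[]] := zP n.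
  have ccos : cos (th n) @[n --> \oo] --> cos th0.
    by apply: (cvg_comp th cos) cth _; exact: continuous_cos.
  have csin : sin (th n) @[n --> \oo] --> sin th0.
    by apply: (cvg_comp th sin) cth _; exact: continuous_sin.
  have null (s_ : nat -> R) (s : R) : s_ n @[n --> \oo] --> s ->
      s_ n * box_bump a b k (y - (z_ n).1) - s * box_bump a b k (y - z0.1) @[n --> \oo] --> 0.
    move=> cs; rewrite -(subrr (s * box_bump a b k (y - z0.1))).
    by apply: cvgB; last exact: cvg_cst; apply: cvgM; last exact: cb.
  pose c n := cos (th n) * box_bump a b k (y - (z_ n).1) - cos th0 * box_bump a b k (y - z0.1).
  pose s n := sin (th n) * box_bump a b k (y - (z_ n).1) - sin th0 * box_bump a b k (y - z0.1).
  have c0 : c n @[n --> \oo] --> 0 by exact: null.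
  have s0 : s n @[n --> \oo] --> 0 by exact: null.
  rewrite (_ : fine \o _ = fun n => c n * c n + s n * s n).
    by rewrite -[X in _ --> X](addr0 0) -[X in _ --> X + _](mulr0 0)
      -[X in _ --> _ + X](mulr0 0); apply: cvgD; apply: cvgM; (exact: c0 || exact: s0).
  apply/funext => n.
  by rewrite -!expr2; exact: (sqmod_expi_sub (th n) th0).
have : (\int[mu]_y (sqmod (G n y - G0 y))%:E)%E @[n --> \oo] -->
    (\int[mu]_y cst 0%E y)%E.
  apply: (@dominated_cvg _ _ _ mu setT measurableT (fun n y => (sqmod (G n y - G0 y))%:E)
    (cst 0%E) (fun y => (4 * \1_(box a' b') y)%:E)) => //.
  - by move=> n; apply/measurable_EFinP; exact: (measurable_sqmod (L2fun_measurable (G n - G0))).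
  - exact: integrable_indic_box.
  - by move=> n y _; rewrite gee0_abs ?lee_fin ?sqmod_ge0.
rewrite integral0; under eq_cvg do rewrite intG.
move=> /fine_cvgP[_ /near_cvg0/(_ _ (exprn_gt0 2 e0))[N /(_ N (leqnn N))]] /=.
rewrite ger0_norm ?sqr_ge0// ltr_sqr ?nnegrE ?rnorm_ge0 ?(ltW e0)//.
by have [_ eN] := zP N; rewrite ltNge eN.
Qed.

(** Constants are integrable over a box, which has finite measure; this makes the real and imaginary
    parts of an L^2 function integrable there. *)
Lemma integrable_box_le (f : L2fun mu) (h : 'rV[R]_d -> R) a b :
  measurable_fun setT h -> (forall y, `|h y| <= sqmod (f y) + 1) ->
  mu.-integrable (box a b) (EFin \o h).
Proof.
move=> mh hf; have mbox := measurable_box a b.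
apply: (le_integrable mbox (g := fun y => (sqmod (f y))%:E + 1%:E)%E).
- by apply/measurable_EFinP; apply: measurable_funTS.
- move=> y _ /=; rewrite lee_fin [leRHS]ger0_norm; first exact: hf.
  by rewrite addr_ge0 ?sqmod_ge0.
apply: integrableD => //.
  by apply: (integrableS measurableT mbox) => //; exact: integrable_sqmod.
have := integrableS measurableT mbox (@subsetT _ _) (integrable_indic_box a b 1).
by apply: eq_integrable => // y yab; rewrite indicE yab mulr1.
Qed.

(** The bumps tend to 1 on the box and stay below its indicator, so dominated convergence applies
    with the absolute value of [h] as majorant. *)
Lemma integral_box_eq0 (h : 'rV[R]_d -> R) a b :
  measurable_fun setT h -> mu.-integrable (box a b) (EFin \o h) ->
  (forall k, \int[mu]_y (h y * box_bump a b k y) = 0) ->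
  \int[mu]_(y in box a b) h y = 0.
Proof.
move=> mh ih h0; have mbox := measurable_box a b.
pose g k y := (h y * box_bump a b k y)%:E.
have g0 k : (\int[mu]_(y in box a b) g k y = 0)%E.
  have -> : (\int[mu]_(y in box a b) g k y = \int[mu]_y g k y)%E.
    rewrite integral_mkcond; apply: eq_integral => y _; rewrite patchE.
    case: (asboolP (box a b y)) => yab; first by rewrite mem_set.
    rewrite memNset// /g (_ : box_bump a b k y = 0) ?mulr0//.
    by rewrite /box_bump box_slack_eq0// oppr0 expR0 expr1n subrr.
  have := h0 k; rewrite /Rintegral -[X in fine X]/(\int[mu]_y g k y)%E => gk.
  rewrite -(@fineK _ (\int[mu]_y g k y)%E) ?gk//.
  have gi : mu.-integrable setT (g k).
    rewrite (_ : g k = (fun y => (h y * box_bump a b k y)%:E) \_ (box a b)).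
      rewrite -integrable_mkcond//.
      apply: (le_integrable mbox (g := EFin \o h)) => //.
        apply/measurable_EFinP; apply: measurable_funTS; apply: measurable_funM => //.
        exact: measurable_box_bump.
      move=> y yab /=; rewrite lee_fin normrM ler_piMr// ger0_norm ?box_bump_ge0//.
      by have := box_bump_le a b k y; rewrite indicE mem_set.
    apply/funext => y; rewrite patchE.
    case: (asboolP (box a b y)) => yab; first by rewrite mem_set.
    rewrite memNset// /g (_ : box_bump a b k y = 0) ?mulr0//.
    by rewrite /box_bump box_slack_eq0// oppr0 expR0 expr1n subrr.
  by apply: integrable_fin_num.
have : (\int[mu]_(y in box a b) g k y)%E @[k --> \oo] -->
    (\int[mu]_(y in box a b) (h y)%:E)%E.
  apply: (@dominated_cvg _ _ _ mu _ mbox g (EFin \o h) (abse \o (EFin \o h))) => //.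
  - move=> k; apply/measurable_EFinP; apply: measurable_funTS.
    by apply: measurable_funM => //; exact: measurable_box_bump.
  - move=> y yab; apply: cvg_EFin; first exact: nearW.
    rewrite -[h y in X in _ --> X]mulr1; apply: cvgM; first exact: cvg_cst.
    exact: box_bump_cvg1.
  - exact: integrable_abse.
  - move=> k y yab /=; rewrite lee_fin normrM ler_piMr// ger0_norm ?box_bump_ge0//.
    by have := box_bump_le a b k y; rewrite indicE mem_set.
under eq_cvg do rewrite g0.
move=> /(cvg_unique _ (cvg_cst _)) h1; rewrite /Rintegral.
by rewrite -h1.
Qed.

(** Testing against the bumps controls the real part of a representative, testing against their
    multiples by ['i] the imaginary part. *)
Lemma L2_bump_total u :
  (forall a b k, B u (\pi_H (L2bump a b k)) = 0 /\
    B u ('i *: \pi_H (L2bump a b k)) = 0) -> u = 0.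
Proof.
elim/quotW: u => f Hf.
have [mre mim] := L2fun_measurable f.
have sqle (y : 'rV[R]_d) : `|complex.Re (f y)| <= sqmod (f y) + 1 /\
    `|complex.Im (f y)| <= sqmod (f y) + 1.
  case: (f y) => p q; rewrite /sqmod /= !ler_norml.
  have := sqr_ge0 (p - 1); have := sqr_ge0 (p + 1).
  have := sqr_ge0 (q - 1); have := sqr_ge0 (q + 1).
  have := sqr_ge0 p; have := sqr_ge0 q.
  by move=> *; split; apply/andP; split; nra.
have re0 : {ae mu, forall y, complex.Re (f y) = 0}.
  have ire a b : mu.-integrable (box a b) (EFin \o (fun y => complex.Re (f y))).
    by apply: (integrable_box_le (f := f)) => // y; have [] := sqle y.
  apply: ae_eq0_box => // a b; apply: integral_box_eq0 => // k.
  have [+ _] := Hf a b k; rewrite L2rdot_pi => h0; rewrite -[RHS]h0.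
  apply: eq_Rintegral => y _ /=.
  by case: (f y) => p q /=; rewrite oppr0 mulr0 subr0.
have im0 : {ae mu, forall y, complex.Im (f y) = 0}.
  have iim a b : mu.-integrable (box a b) (EFin \o (fun y => complex.Im (f y))).
    by apply: (integrable_box_le (f := f)) => // y; have [] := sqle y.
  apply: ae_eq0_box => // a b; apply: integral_box_eq0 => // k.
  have [_ +] := Hf a b k; rewrite L2_scale_pi L2rdot_pi => h0; rewrite -[RHS]h0.
  apply: eq_Rintegral => y _; rewrite L2funZE /=.
  by case: (f y) => p q /=; ring.
rewrite -[RHS](raddf0 (\pi_H)); apply/L2_piP; apply: filterS2 re0 im0 => y.
by case: (f y) => p q /= -> ->.
Qed.

(* The vectors with continuous orbit form a closed subspace, and a vector
   orthogonal to all [L2bump] has vanishing integrals over boxes. *)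
Lemma tf_shift_strongly_continuous u : shift_continuous u.
Proof.
(* Shifts are isometries, so replacing [v] by [w] costs the same at every [z]; this uniformity makes
   the class of vectors with continuous orbit closed. *)
have D2 v w z z0 : rnorm (tf_shift z v - tf_shift z0 v) <=
    rnorm (tf_shift z w - tf_shift z0 w) + 2 * rnorm (v - w).
  have := rnorm_triangle (tf_shift z w) (tf_shift z v) (tf_shift z0 v).
  have := rnorm_triangle (tf_shift z0 w) (tf_shift z w) (tf_shift z0 v).
  by rewrite -!tf_shiftB !rnorm_tf_shift [rnorm (w - v)]rnormBC; lra.
have WZ (c : R[i]) v : shift_continuous v -> shift_continuous (c *: v).
  move=> vW z0 e e0; have c0 : 0 < Normc.normc c + 1.
    by rewrite ltr_wpDl// modulus_ge0.
  have [del del0 delP] := vW z0 _ (divr_gt0 e0 c0).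
  exists del => // z /delP; rewrite ltr_pdivlMr// => lte.
  rewrite !tf_shiftZ -scalerBr rnormZ; apply: le_lt_trans lte.
  by rewrite mulrC ler_wpM2l ?rnorm_ge0// lerDl.
have WD v w : shift_continuous v -> shift_continuous w -> shift_continuous (v + w).
  move=> vW wW z0 e e0; have e20 : 0 < e / 2 by rewrite divr_gt0.
  have [d1 d10 d1P] := vW z0 _ e20; have [d2 d20 d2P] := wW z0 _ e20.
  exists (Num.min d1 d2); first by rewrite lt_min d10.
  move=> z zz0; rewrite !tf_shiftD opprD addrACA [e]splitr.
  apply: le_lt_trans (rnormD _ _) _; apply: ltrD.
    by apply: d1P => i; have [] := zz0 i; rewrite !lt_min => /andP[? _] /andP[].
  by apply: d2P => i; have [] := zz0 i; rewrite !lt_min => /andP[_ ?] /andP[].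
have [||||w wW wP] := hilbert_projection hB (W := fun v => shift_continuous v) u.
- move=> z0 e e0; exists 1 => // z _.
  by rewrite -(scale0r 0) !tf_shiftZ !scale0r subrr rnorm0.
- exact: WD.
- by move=> c v; exact: WZ.
- move=> v H z0 e e0; have e40 : 0 < e / 4 by rewrite divr_gt0.
  have [w wW vw] := H _ e40; have e20 : 0 < e / 2 by rewrite divr_gt0.
  have [del del0 delP] := wW z0 _ e20; exists del => // z /delP zw.
  by apply: le_lt_trans (D2 v w z z0) _; lra.
suff : u - w = 0 by move/eqP; rewrite subr_eq0 => /eqP->.
apply: L2_bump_total => a b k.
by split; apply: wP; [|apply: WZ]; exact: shift_continuous_bump.
Qed.

End strong_continuity.

(** * Convergence in L^p over a subset of phase space *)

Section Lp_norm_convergence.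
Context (R : realType).

(** Away from 0 the power is [expR (p * ln x)]; a limit equal to 0, where [ln] is not continuous, is
    settled with the threshold obtained from [e] by the power [p^-1]. *)
Lemma cvg_powR (p : R) (u_ : nat -> R) (l : R) : 0 < p ->
  (forall n, 0 <= u_ n) -> u_ n @[n --> \oo] --> l ->
  u_ n `^ p @[n --> \oo] --> l `^ p.
Proof.
move=> p0 u0 ul; have l0 : 0 <= l.
  by apply: (cvgr_to_ge ul); apply: nearW.
move: l0; rewrite le_eqVlt => /predU1P[l0|l0].
  rewrite -{l}l0 in ul *; rewrite powR0 ?gt_eqF//.
  apply/near_cvg0 => e e0; have e1 : 0 < e `^ p^-1 by exact: powR_gt0.
  have [N NP] := (near_cvg0 u_).1 ul _ e1; exists N => n /NP.
  rewrite ger0_norm// ger0_norm ?powR_ge0// => ue.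
  have := gt0_ltr_powR p0 (u0 n) (powR_ge0 _ _) ue.
  by rewrite -powRrM mulVf ?gt_eqF// powRr1// ltW.
have lE (x : R) : 0 < x -> x `^ p = expR (p * ln x) by move=> x0; rewrite /powR gt_eqF.
rewrite lE//.
have H : expR (p * ln (u_ n)) @[n --> \oo] --> expR (p * ln l).
  apply: (continuous_cvg _ (@continuous_expR R _)).
  apply: cvgM; first exact: cvg_cst.
  by apply: (continuous_cvg _ (@continuous_ln R _ l0)).
apply: cvg_trans H; apply: near_eq_cvg.
have l20 : 0 < l / 2 by rewrite divr_gt0.
move/cvgrPdist_lt : ul => /(_ _ l20); apply: filterS => n.
by rewrite ltr_norml => /andP[_ ?]; rewrite lE//; lra.
Qed.

Context (d : measure_display) (T : measurableType d).
Variables (nu : {measure set T -> \bar R}) (Omega : set T) (p : R).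
Hypotheses (mOmega : measurable Omega) (p1 : 1 <= p).

Let p0 : 0 < p. Proof. exact: lt_le_trans p1. Qed.

Lemma Lnorm_restrict (q : T -> R) : (forall x, 0 <= q x) ->
  ('N[nu]_p%:E[(EFin \o q) \_ Omega] =
    (\int[nu]_(x in Omega) (q x `^ p)%:E) `^ p^-1)%E.
Proof.
move=> q0; rewrite unlock; congr poweR; rewrite [RHS]integral_mkcond.
apply: eq_integral => x _; rewrite !patchE; case: ifP => _ /=.
  by rewrite ger0_norm.
by rewrite normr0 powR0// gt_eqF.
Qed.

(** Chebyshev's inequality, in the form that contradicts smallness of the norm. *)
Lemma Lnorm_ge (q : T -> R) (A : set T) (c : R) : measurable_fun setT q ->
  (forall x, 0 <= q x) -> measurable A -> A `<=` Omega -> 0 <= c ->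
  (forall x, A x -> c <= q x) ->
  (((c `^ p)%:E * nu A) `^ p^-1 <= 'N[nu]_p%:E[(EFin \o q) \_ Omega])%E.
Proof.
move=> mq q0 mA AO c0 cq; rewrite Lnorm_restrict//.
have mqp : measurable_fun setT (fun x => (q x `^ p)%:E).
  by apply/measurable_EFinP; exact: (measurableT_comp (measurable_powR p) mq).
apply: gt0_ler_poweR; rewrite ?invr_ge0 ?(ltW p0)//.
- by rewrite in_itv/= leey andbT mule_ge0// lee_fin powR_ge0.
- by rewrite in_itv/= leey andbT integral_ge0// => x _; rewrite lee_fin powR_ge0.
rewrite -(integral_cst nu mA).
apply: (@le_trans _ _ (\int[nu]_(x in A) (q x `^ p)%:E)%E).
  apply: ge0_le_integral => //.
  - by move=> x _; rewrite lee_fin powR_ge0.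
  - exact: measurable_funTS.
  - by move=> x Ax; rewrite lee_fin ge0_ler_powR ?nnegrE ?(ltW p0) ?cq.
apply: ge0_subset_integral => //; first exact: measurable_funTS.
by move=> x _; rewrite lee_fin powR_ge0.
Qed.

(** The majorant is the constant p-th power of [C], integrable because Omega has finite measure;
    continuity of the power [p^-1] then passes from integrals to norms. *)
Lemma Lnorm_dominated_cvg (q_ : nat -> T -> R) (q : T -> R) (C : R) :
  (nu Omega < +oo)%E ->
  (forall n, measurable_fun setT (q_ n)) ->
  (forall n x, 0 <= q_ n x <= C) -> (forall x, 0 <= q x <= C) ->
  (forall x, q_ n x @[n --> \oo] --> q x) ->
  'N[nu]_p%:E[(EFin \o q_ n) \_ Omega]%E @[n --> \oo] -->
  'N[nu]_p%:E[(EFin \o q) \_ Omega]%E.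
Proof.
move=> Ooo mq_ qC_ qC qq.
have mq : measurable_fun setT q.
  by apply: (@measurable_fun_cvg _ _ _ setT q_) => // x _; exact: qq.
have q0 x : 0 <= q x by have /andP[] := qC x.
have q0_ n x : 0 <= q_ n x by have /andP[] := qC_ n x.
rewrite Lnorm_restrict//; under eq_cvg do rewrite Lnorm_restrict//.
have mpow (h : T -> R) : measurable_fun setT h ->
    measurable_fun Omega (fun x => (h x `^ p)%:E).
  move=> mh; apply: measurable_funTS; apply/measurable_EFinP.
  exact: (measurableT_comp (measurable_powR p) mh).
have leC (h : R) : 0 <= h <= C -> h `^ p <= C `^ p.
  by move=> /andP[h0 hC]; rewrite ge0_ler_powR ?nnegrE ?(ltW p0)// (le_trans h0).
have iC : nu.-integrable Omega (fun=> (C `^ p)%:E).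
  apply/integrableP; split => //.
  rewrite integral_cst//= lte_mul_pinfty// ?lee_fin ?normr_ge0//.
have I_fin (h : T -> R) : measurable_fun setT h -> (forall x, 0 <= h x <= C) ->
    (\int[nu]_(x in Omega) (h x `^ p)%:E)%E \is a fin_num.
  move=> mh hC; apply: integrable_fin_num => //.
  apply: (le_integrable mOmega _ _ iC); first exact: mpow.
  by move=> x _ /=; rewrite lee_fin !ger0_norm ?powR_ge0// leC.
have Icvg : fine (\int[nu]_(x in Omega) (q_ n x `^ p)%:E)%E @[n --> \oo] -->
    fine (\int[nu]_(x in Omega) (q x `^ p)%:E)%E.
  apply: fine_cvg; rewrite fineK ?I_fin//.
  apply: (@dominated_cvg _ _ _ nu Omega mOmega (fun n x => (q_ n x `^ p)%:E)
    (fun x => (q x `^ p)%:E) (fun=> (C `^ p)%:E)) => //.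
  - by move=> n; exact: mpow.
  - by move=> x _; apply: cvg_EFin; [exact: nearW | exact: cvg_powR].
  - by move=> n x _; rewrite gee0_abs ?lee_fin ?powR_ge0// leC.
have powE (h : T -> R) : measurable_fun setT h -> (forall x, 0 <= h x <= C) ->
    ((\int[nu]_(x in Omega) (h x `^ p)%:E) `^ p^-1 =
     (fine (\int[nu]_(x in Omega) (h x `^ p)%:E)%E `^ p^-1)%:E)%E.
  by move=> mh hC; rewrite -poweR_EFin fineK// I_fin.
suff H : (fine (\int[nu]_(x in Omega) (q_ n x `^ p)%:E)%E `^ p^-1)%:E @[n --> \oo] -->
    (fine (\int[nu]_(x in Omega) (q x `^ p)%:E)%E `^ p^-1)%:E.
  rewrite (powE q mq qC); apply: cvg_trans H; apply: near_eq_cvg; apply: nearW => n.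
  by rewrite (powE _ (mq_ n) (qC_ n)).
apply: cvg_EFin; first exact: nearW.
apply: cvg_powR => //; first by rewrite invr_gt0.
by move=> n; rewrite fine_ge0// integral_ge0// => x _; rewrite lee_fin powR_ge0.
Qed.

End Lp_norm_convergence.

(** * Grids and measurability on phase space *)

Section phase_space.
Context (R : realType) (d : nat).
Local Notation mu := (@lebesgue_rV R d).
Local Notation phase_space := ('rV[R]_d * 'rV[R]_d)%type.
Local Notation cara := (caratheodory_type ((mu \x mu)%E^*)%mu).
Local Notation nu := (@completed_measure_extension _ _ R (mu \x mu)%E).
Implicit Types z : phase_space.

Definition grid (k : nat) (x : 'rV[R]_d) : 'rV[int]_d :=
  \row_i Num.floor (k.+1%:R * x 0 i).

Definition grid_point (k : nat) (m : 'rV[int]_d) : 'rV[R]_d :=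
  \row_i ((m 0 i)%:~R / k.+1%:R).

Definition cell (k : nat) (m : 'rV[int]_d * 'rV[int]_d) : set phase_space :=
  [set z | grid k z.1 = m.1 /\ grid k z.2 = m.2].

Lemma grid_dist k (x y : 'rV[R]_d) i : grid k x = grid k y ->
  `|x 0 i - y 0 i| < k.+1%:R^-1.
Proof.
move=> /rowP/(_ i); rewrite !mxE => xy.
have k0 : 0 < k.+1%:R :> R by [].
have := floor_itv (k.+1%:R * x 0 i); have := floor_itv (k.+1%:R * y 0 i).
rewrite xy intrD => /andP[? ?] /andP[? ?].
rewrite -[ltRHS]mul1r ltr_pdivlMr// -[X in _ * X]gtr0_norm// -normrM ltr_norml.
by apply/andP; split; lra.
Qed.

Lemma grid_point_dist k (x : 'rV[R]_d) i :
  `|grid_point k (grid k x) 0 i - x 0 i| < k.+1%:R^-1.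
Proof.
rewrite !mxE; have k0 : 0 < k.+1%:R :> R by [].
have := floor_itv (k.+1%:R * x 0 i); rewrite intrD => /andP[? ?].
rewrite -[ltRHS]mul1r ltr_pdivlMr// -[X in _ * X]gtr0_norm// -normrM ltr_norml.
by rewrite mulrBl divfK ?gt_eqF//; apply/andP; split; lra.
Qed.

Lemma measurable_grid k (m : 'rV[int]_d) : measurable [set x | grid k x = m].
Proof.
have -> : [set x | grid k x = m] = \bigcap_(i in [set: 'I_d])
    ((fun x : 'rV[R]_d => x 0 i : measurableTypeR R) @^-1`
      `[((m 0 i)%:~R / k.+1%:R), ((m 0 i + 1)%:~R / k.+1%:R)[%classic).
  have k0 : 0 < k.+1%:R :> R by [].
  have E (x : 'rV[R]_d) i : (Num.floor (k.+1%:R * x 0 i) == m 0 i) =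
      ((m 0 i)%:~R / k.+1%:R <= x 0 i < (m 0 i + 1)%:~R / k.+1%:R).
    by rewrite floor_eq ler_pdivrMr// ltr_pdivlMr// [x 0 i * _]mulrC.
  apply/seteqP; split=> x /= => [xm i _|xm].
    by rewrite /= in_itv/= -E -xm mxE.
  apply/rowP => i; rewrite mxE; apply/eqP; rewrite E.
  by have := xm i Logic.I; rewrite /= in_itv.
apply: fin_bigcap_measurable => [|i _]; first exact: finite_finset.
by rewrite -[X in measurable X]setTI; exact: measurable_coord.
Qed.

Lemma measurable_cell k m : measurable (cell k m).
Proof.
have -> : cell k m = [set x | grid k x = m.1] `*` [set x | grid k x = m.2] by [].
by apply: measurableX; exact: measurable_grid.
Qed.

(** [F] is the limit of its values at the lower corners of finer and finer grid cells; each
    approximant is constant on countably many measurable cells. *)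
Lemma measurable_fun_sequential (F : phase_space -> R) :
  (forall z (z_ : nat -> phase_space),
    (forall n, close_points n.+1%:R^-1 (z_ n) z) -> F (z_ n) @[n --> \oo] --> F z) ->
  measurable_fun setT F.
Proof.
move=> Fcts.
pose P k (m : 'rV[int]_d * 'rV[int]_d) : phase_space := (grid_point k m.1, grid_point k m.2).
pose G k z := F (P k (grid k z.1, grid k z.2)).
apply: (@measurable_fun_cvg _ _ _ setT G) => [k|z _]; last first.
  by apply: Fcts => n i; split; exact: grid_point_dist.
move=> _ Y mY; rewrite setTI.
have -> : G k @^-1` Y = \bigcup_m (if F (P k m) \in Y then cell k m else set0).
  apply/seteqP; split=> [z /= GY|z [m _]].
    by exists (grid k z.1, grid k z.2) => //; rewrite mem_set.
  case: ifPn => // /set_mem PY; rewrite /cell/=; case: m PY => m1 m2 PY [/= E1 E2].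
  by rewrite /G E1 E2.
apply: countable_bigcupT_measurable => [|m]; first exact: countableP.
by case: ifP => _; [exact: measurable_cell | exact: measurable0].
Qed.

Lemma measurable_cara (A : set phase_space) : measurable A -> measurable (A : set cara).
Proof. by move=> mA; apply: sub_caratheodory; exact: sub_sigma_algebra. Qed.

Lemma measurable_fun_cara (F : phase_space -> R) :
  measurable_fun setT F -> measurable_fun [set: cara] (F : cara -> R).
Proof.
move=> mF _ Y mY; rewrite setTI; apply: measurable_cara.
by rewrite -[X in measurable X]setTI; exact: mF.
Qed.

(* A Lindelof argument with the countably many grid cells. *)
Lemma positive_measure_point (Omega : set cara) :
  measurable Omega -> (0 < nu Omega)%E ->
  exists z0 : phase_space, forall del : R, 0 < del ->
    exists A : set cara, [/\ measurable A, A `<=` Omega, (0 < nu A)%E &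
      forall z, A z -> close_points del z z0].
Proof.
move=> mO O0; apply: contrapT => Hno.
have H z : exists del : R, 0 < del /\ forall A : set cara, measurable A -> A `<=` Omega ->
    (forall z', A z' -> close_points del z' z) -> nu A = 0%E.
  apply: contrapT => Hz; apply: Hno; exists z => del del0.
  apply: contrapT => HA; apply: Hz; exists del; split => // A mA AO Az.
  apply/eqP; rewrite eq_le measure_ge0 andbT leNgt; apply/negP => A0.
  by apply: HA; exists A.
have [del delP] := choice H.
pose C k m : set cara := cell k m `&` Omega.
have mC k m : measurable (C k m).
  by apply: measurableI => //; apply: measurable_cara; exact: measurable_cell.
(* Only cells whose part in Omega is null are kept, and codes of no cell give the empty set. The
   union is negligible, yet under the assumption to be refuted it covers Omega. *)
pose N (j : nat) : set cara := if @unpickle (nat * ('rV[int]_d * 'rV[int]_d))%type j is Some (k, m)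
  then (if nu (C k m) == 0%E then C k m else set0) else set0.
have : nu.-negligible (\bigcup_j N j).
  apply: negligible_bigcup => j; rewrite /N.
  case: (unpickle j) => [[k m]|]; last exact: negligible_set0.
  case: eqP => [C0|_]; last exact: negligible_set0.
  by exists (C k m); split.
have ON : Omega `<=` \bigcup_j N j.
  move=> z Oz; have [del0 delN] := delP z.
  have [k] := ltr_add_invr del0; rewrite add0r => kdel.
  pose m := (grid k z.1, grid k z.2).
  have C0 : nu (C k m) = 0%E.
    apply: delN => //; first exact: subIsetr.
    move=> z' [[/= E1 E2] _] i.
    by split; apply: lt_trans kdel; exact: grid_dist.
  exists (pickle (k, m)) => //.
  by rewrite /N pickleK C0 eqxx.
move=> /(negligibleS ON) /(measure_negligible mO) O00.
by rewrite O00 ltxx in O0.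
Qed.

End phase_space.

(** * Weak continuity and compactness *)

Section weak_continuity.
Context (R : realType) (d : nat).
Local Notation mu := (@lebesgue_rV R d).
Local Notation H := (L2 mu).
Local Notation phase_space := ('rV[R]_d * 'rV[R]_d)%type.
Local Notation B := (L2rdot (mu := mu)).
Implicit Types (u v : H) (z : phase_space) (S : {linear H -> H}).

Let hB : hilbert B := L2_hilbert mu.

Lemma normc_le (a b : R) : Normc.normc (a +i* b) <= `|a| + `|b|.
Proof.
rewrite /= -[leRHS]ger0_norm ?addr_ge0// -sqrtr_sqr ler_wsqrtr//.
rewrite -[a ^+ 2]real_normK ?num_real// -[b ^+ 2]real_normK ?num_real//.
by have := normr_ge0 a; have := normr_ge0 b; nra.
Qed.

Lemma normc_L2dot u v : Normc.normc (L2dot u v) <= 2 * (rnorm u * rnorm v).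
Proof.
rewrite L2dotE; apply: le_trans (normc_le _ _) _.
have := cauchy_schwarz hB u v; have := cauchy_schwarz hB u ('i *: v).
by rewrite rnormI; move: (_ * _) => r; lra.
Qed.

Lemma L2dotBl u v w : L2dot (u - v) w = L2dot u w - L2dot v w.
Proof. by rewrite !L2dotE !(hilbertBl hB); simpc. Qed.

Lemma normc_dist (x y : R[i]) : `|Normc.normc x - Normc.normc y| <= Normc.normc (x - y).
Proof.
have := le_normcD (x - y) y; rewrite subrK => h1.
have := le_normcD (y - x) x; rewrite subrK -(normcN (y - x)) opprB => h2.
by rewrite ler_norml; apply/andP; split; lra.
Qed.

Lemma alphaE z S u : alpha z S u = tf_shift z (S (tf_unshift z u)).
Proof. by rewrite /alpha adjoint_tf_shift. Qed.

Lemma QE S u z : Q S u z = L2dot (S (tf_unshift z u)) (tf_unshift z u).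
Proof. by rewrite /Q alphaE L2dot_tf_shift. Qed.

Lemma alphaZ z S (a : R[i]) u : alpha z S (a *: u) = a *: alpha z S u.
Proof. by rewrite !alphaE tf_unshiftZ linearZ tf_shiftZ. Qed.

Lemma close_points_nbhs z0 (X : set phase_space) :
  nbhs z0 X <-> exists2 del, 0 < del & forall z, close_points del z z0 -> X z.
Proof.
split=> [/nbhs_ballP[e /= e0 eX]|[del del0 delX]].
  exists e => // z zz0; apply: eX; split; split=> // i j.
    by rewrite (ord1 i); have [+ _] := zz0 j; rewrite distrC.
  by rewrite (ord1 i); have [_ +] := zz0 j; rewrite distrC.
apply/nbhs_ballP; exists del => // z [[_ z1] [_ z2]]; apply: delX => i.
by split; rewrite distrC; [exact: z1 | exact: z2].
Qed.

(** [opnorm] is extended-valued, so its convergence to 0 also says that it is eventually finite;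
    homogeneity of [alpha z S] passes between the supremum over the ball and the bound
    [e * rnorm u]. *)
Lemma C_u_alphaP S : C_u_alpha R d S <-> bounded_operators S /\
  forall z0 (e : R), 0 < e -> exists2 del, 0 < del & forall z, close_points del z z0 ->
    forall u, rnorm (alpha z S u - alpha z0 S u) <= e * rnorm u.
Proof.
split=> -[bS cS]; split=> // z0.
  move=> e e0; have /fine_cvgP[near_fin /cvgr0Pnorm_lt/(_ e e0) near_lt] := cS z0.
  have /close_points_nbhs[del del0 delP] : nbhs z0 [set z |
      opnorm (alpha z S \- alpha z0 S) \is a fin_num /\
      `|fine (opnorm (alpha z S \- alpha z0 S))| < e].
    by apply: filterS2 near_fin near_lt.
  exists del => // z /delP[/= op_fin op_lt] u.
  have [/eqP|u0] := eqVneq (rnorm u) 0.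
    rewrite rnorm_eq0 => /eqP->.
    by rewrite -(scale0r 0) !alphaZ !scale0r subrr !rnorm0 mulr0.
  have up : 0 < rnorm u by rewrite lt_def u0 rnorm_ge0.
  pose v := (rnorm u)^-1%:C *: u.
  have v1 : rnorm v = 1 by rewrite rnormZR ger0_norm ?invr_ge0 ?rnorm_ge0// mulVf.
  have : ((rnorm (alpha z S v - alpha z0 S v))%:E <= opnorm (alpha z S \- alpha z0 S)%R)%E.
    apply: ereal_sup_ubound; exists v => //=.
    by rewrite normE v1.
  rewrite -(fineK op_fin) lee_fin => /le_trans/(_ (le_trans (ler_norm _) (ltW op_lt))).
  rewrite /v !alphaZ -scalerBr rnormZR ger0_norm ?invr_ge0 ?rnorm_ge0//.
  by rewrite mulrC ler_pdivrMr.
have op_ge0 z : (0 <= opnorm (alpha z S \- alpha z0 S)%R)%E.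
  apply: ereal_sup_ge; exists (rnorm (alpha z S 0 - alpha z0 S 0))%:E.
    by exists 0 => //=; rewrite normr0 ler01.
  by rewrite lee_fin rnorm_ge0.
have op_le (e : R) : 0 < e -> \forall z \near z0, (opnorm (alpha z S \- alpha z0 S)%R <= e%:E)%E.
  move=> e0; have [del del0 delP] := cS z0 e e0; apply/close_points_nbhs; exists del => // z /delP zS.
  apply: ge_ereal_sup => _ [v /= v1 <-]; rewrite lee_fin.
  apply: le_trans (zS v) _; move: v1; rewrite normE -(rmorph1 (real_complex R)) lecR.
  exact/ler_piMr/ltW.
apply/fine_cvgP; split.
  apply: filterS (op_le 1 ltr01) => z op1.
  by rewrite ge0_fin_numE// (le_lt_trans op1)// ltry.
apply/cvgr0Pnorm_lt => e e0; have e20 : 0 < e / 2 by rewrite divr_gt0.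
apply: filterS (op_le _ e20) => z opz /=.
have op_fin : opnorm (alpha z S \- alpha z0 S) \is a fin_num.
  by rewrite ge0_fin_numE// (le_lt_trans opz)// ltry.
move: opz (op_ge0 z); rewrite -(fineK op_fin) !lee_fin => opz fin_ge0.
rewrite (ger0_norm fin_ge0); apply: le_lt_trans opz _.
by rewrite ltr_pdivrMr// ltr_pMr// ltr1n.
Qed.

Lemma Q_cvg S u z (z_ : nat -> phase_space) : C_u_alpha R d S ->
  (forall n, close_points n.+1%:R^-1 (z_ n) z) ->
  Normc.normc (Q S u (z_ n)) @[n --> \oo] --> Normc.normc (Q S u z).
Proof.
move=> /C_u_alphaP[_ cS] zz; apply/cvgrPdist_le => e e0.
(* The 2 comes from [normc_L2dot]; the [+ 1] keeps [c] positive when [u = 0]. *)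
pose c := 2 * rnorm u ^+ 2 + 1; have c0 : 0 < c.
  by rewrite ltr_wpDl// mulr_ge0// sqr_ge0.
have [del del0 delP] := cS z _ (divr_gt0 e0 c0).
have [N] := ltr_add_invr del0; rewrite add0r => Ndel.
exists N => // n Nn; rewrite distrC.
apply: le_trans (normc_dist _ _) _; rewrite /Q -L2dotBl.
apply: le_trans (normc_L2dot _ _) _.
have /delP/(_ u) H : close_points del (z_ n) z.
  move=> i; have Nn' : n.+1%:R^-1 < del.
    by apply: le_lt_trans Ndel; rewrite lef_pV2 ?posrE// ler_nat.
  by have [? ?] := zz n i; split; apply: lt_trans Nn'.
have H2 := ler_wpM2r (rnorm_ge0 u) H.
have ec : e = e / c * c by rewrite divfK ?gt_eqF.
have ec0 : 0 <= e / c by rewrite divr_ge0 ?ltW.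
rewrite [leRHS]ec; move: H2 ec0; move: (e / c) => q; rewrite /c.
by move: (rnorm (_ - _)) (rnorm u) => a b; lra.
Qed.

Lemma measurable_Q S u : C_u_alpha R d S ->
  measurable_fun [set: caratheodory_type ((mu \x mu)%E^*)%mu]
    (fun z : caratheodory_type ((mu \x mu)%E^*)%mu => Normc.normc (Q S u z)).
Proof.
move=> cS; apply: (@measurable_fun_cara R d (fun z => Normc.normc (Q S u z))).
by apply: measurable_fun_sequential => z z_ zz; exact: Q_cvg.
Qed.

Lemma Q_bound S (M : R) u z : 0 <= M -> (forall v, rnorm (S v) <= M * rnorm v) ->
  Normc.normc (Q S u z) <= 2 * (M * rnorm u ^+ 2).
Proof.
move=> M0 SM; rewrite QE; apply: le_trans (normc_L2dot _ _) _.
rewrite rnorm_tf_unshift ler_wpM2l// expr2 mulrA ler_wpM2r ?rnorm_ge0//.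
by apply: le_trans (SM _) _; rewrite rnorm_tf_unshift.
Qed.

Lemma tf_shift_equicontinuous (s : seq H) z0 (e : R) : 0 < e ->
  exists2 del, 0 < del & forall z, close_points del z z0 ->
    forall y, y \in s -> rnorm (tf_shift z y - tf_shift z0 y) < e.
Proof.
move=> e0; elim: s => [|y s [del1 del10 delP1]]; first by exists 1.
have [del2 del20 delP2] := tf_shift_strongly_continuous y z0 e0.
exists (Num.min del1 del2); first by rewrite lt_min del10.
move=> z zz0 x; rewrite in_cons => /predU1P[->|xs].
  by apply: delP2 => i; have [] := zz0 i; rewrite !lt_min => /andP[_ ?] /andP[].
apply: delP1 => // i.
by have [] := zz0 i; rewrite !lt_min => /andP[? _] /andP[].
Qed.

(** The difference splits into a shift applied to [S (tf_unshift z u) - w] and the difference of two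
    shifts applied to [w]. In the first, pairing with the finite list of [compact_small] moves the
    variation in [z] onto fixed vectors; in the second, [w] is near a finite net. *)
Lemma compact_C_u_alpha S : compact_operators H S -> C_u_alpha R d S.
Proof.
move=> cS; apply/C_u_alphaP; split; first exact: (compact_operator_bounded hB cS).
move=> z0 e e0.
have e4 : 0 < e / 4 by rewrite divr_gt0.
have e6 : 0 < e / 6 by rewrite divr_gt0.
have [del0 del00 [s sP]] := compact_small hB cS e4.
have /(compact_operatorsP hB)/(_ _ e6)[t tP] := cS.
have [del1 del10 delP1] := tf_shift_equicontinuous s z0 del00.
have [del2 del20 delP2] := tf_shift_equicontinuous t z0 e6.
exists (Num.min del1 del2); first by rewrite lt_min del10.
move=> z zz0.
have c1 : close_points del1 z z0.
  by move=> i; have [] := zz0 i; rewrite !lt_min => /andP[? _] /andP[].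
have c2 : close_points del2 z z0.
  by move=> i; have [] := zz0 i; rewrite !lt_min => /andP[_ ?] /andP[].
have unit u : rnorm u <= 1 -> rnorm (alpha z S u - alpha z0 S u) <= e.
  move=> u1; rewrite !alphaE.
  pose w := S (tf_unshift z0 u).
  (* Halving puts the difference in the unit ball and turns the bound [e / 4] into [e / 2]; the
     other [e / 2] is spent as three times [e / 6]. *)
  pose g := (2^-1)%:C *: (tf_unshift z u - tf_unshift z0 u).
  have g1 : rnorm g <= 1.
    rewrite rnormZR ger0_norm//.
    have := rnormB (tf_unshift z u) (tf_unshift z0 u).
    by rewrite !rnorm_tf_unshift; lra.
  have Sg : rnorm (S g) <= e / 4.
    apply: sP => // y ys; rewrite (hilbertZl hB) (hilbertBl hB).
    rewrite !L2rdot_tf_unshift -(hilbertBr hB) normrM ger0_norm//.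
    apply: le_trans (ler_piMl (normr_ge0 _) _) _; first by rewrite invf_le1// ler1n.
    apply: le_trans (cauchy_schwarz hB _ _) _.
    apply: le_trans (ler_piMl (rnorm_ge0 _) u1) _.
    exact/ltW/delP1.
  have Sdiff : rnorm (S (tf_unshift z u) - w) <= e / 2.
    rewrite /w -linearB; move: Sg; rewrite /g linearZ rnormZR ger0_norm//=; lra.
  have [y yt wy] : exists2 y, y \in t & rnorm (w - y) < e / 6.
    by apply: tP; rewrite rnorm_tf_unshift.
  have zy := delP2 _ c2 _ yt.
  have h1 := rnorm_triangle (tf_shift z w) (tf_shift z (S (tf_unshift z u))) (tf_shift z0 w).
  have h2 := rnorm_triangle (tf_shift z y) (tf_shift z w) (tf_shift z0 w).
  have h3 := rnorm_triangle (tf_shift z0 y) (tf_shift z y) (tf_shift z0 w).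
  move: h1 h2 h3; rewrite -!tf_shiftB !rnorm_tf_shift [rnorm (y - w)]rnormBC => h1 h2 h3.
  apply: le_trans h1 _; rewrite [leRHS]splitr; apply: lerD; first exact: Sdiff.
  apply: le_trans h2 _; apply: le_trans (lerD (ltW wy) h3) _.
  apply: le_trans (lerD (lexx _) (lerD (ltW zy) (ltW wy))) _.
  by rewrite le_eqVlt; apply/orP; left; apply/eqP; field.
move=> u; have [/eqP|u0] := eqVneq (rnorm u) 0.
  rewrite rnorm_eq0 => /eqP->.
  by rewrite -(scale0r 0) !alphaZ !scale0r subrr !rnorm0 mulr0.
have up : 0 < rnorm u by rewrite lt_def u0 rnorm_ge0.
have := unit ((rnorm u)^-1%:C *: u).
rewrite !alphaZ -scalerBr !rnormZR ger0_norm ?invr_ge0 ?rnorm_ge0// mulVf//.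
by move=> /(_ (lexx _)); rewrite mulrC ler_pdivrMr.
Qed.

(** Rescaling by [K] puts [u_ n - u] in the unit ball, where [compact_small] asks only for finitely
    many small pairings. *)
Lemma compact_weak_to_norm (T : {linear H -> H}) (u_ : nat -> H) u (M : R) :
  compact_operators H T -> (forall n, rnorm (u_ n) <= M) ->
  (forall v, B (u_ n) v @[n --> \oo] --> B u v) ->
  rnorm (T (u_ n) - T u) @[n --> \oo] --> 0.
Proof.
move=> cT uM wu; pose K := M + rnorm u + 1.
have M0 : 0 <= M := le_trans (rnorm_ge0 _) (uM 0%N).
have K0 : 0 < K by rewrite ltr_wpDl// addr_ge0// rnorm_ge0.
pose g n := K^-1%:C *: (u_ n - u).
have KV0 : 0 < K^-1 by rewrite invr_gt0.
have g1 n : rnorm (g n) <= 1.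
  rewrite rnormZR gtr0_norm// mulrC ler_pdivrMr// mul1r.
  apply: le_trans (rnormB _ _) _; rewrite /K.
  by have := uM n; lra.
have gw v : B (g n) v @[n --> \oo] --> 0.
  under eq_cvg do rewrite (hilbertZl hB) (hilbertBl hB).
  have := cvgM (@cvg_cst _ K^-1 _ \oo _) (cvgB (wu v) (@cvg_cst _ (B u v) _ \oo _)).
  by rewrite subrr mulr0; exact.
have gsmall (s : seq H) (del : R) : 0 < del -> exists N, forall n, (N <= n)%N ->
    forall y, y \in s -> `|B (g n) y| <= del.
  move=> del0; elim: s => [|y s [N1 N1P]]; first by exists 0%N.
  have [N2 N2P] := (near_cvg0 _).1 (gw y) _ del0.
  exists (maxn N1 N2) => n; rewrite geq_max => /andP[nN1 nN2] x.
  by rewrite in_cons => /predU1P[->|xs]; [exact/ltW/N2P | exact: N1P].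
apply/near_cvg0 => e e0; have eK : 0 < e / (2 * K) by rewrite divr_gt0// mulr_gt0.
have [del del0 [s sP]] := compact_small hB cT eK.
have [N NP] := gsmall s del del0; exists N => n /NP gs.
have := sP (g n) (g1 n) gs.
rewrite linearZ linearB rnormZR gtr0_norm// mulrC ler_pdivrMr//= ger0_norm ?rnorm_ge0//.
move=> /le_lt_trans; apply.
have -> : e / (2 * K) * K = e / 2 by field; rewrite gt_eqF.
by rewrite ltr_pdivrMr// ltr_pMr// ltr1n.
Qed.

Lemma compact_B_wc S (p : R) (Omega : set phase_space) : 1 <= p ->
  phase_measurable Omega -> (phase_measure Omega < +oo)%E ->
  compact_operators H S -> B_wc p Omega S.
Proof.
move=> p1 mO Ooo cS; have bS := compact_operator_bounded hB cS; split=> // u_ u.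
move=> /(weakly_convergesP hB) wu.
have [M0 uM0] : exists M, forall n, rnorm (u_ n) <= M.
  apply: (hilbert_uniform_boundedness hB) => v.
  have /cvg_seq_bounded[K [_ /(_ (K + 1))]] : cvgn (fun n => B (u_ n) v).
    by apply/cvg_ex; exists (B u v); exact: wu.
  by rewrite ltrDl ltr01 => /(_ isT) KP; exists (K + 1) => n; exact: KP.
pose M := M0 + rnorm u.
have M00 : 0 <= M0 := le_trans (rnorm_ge0 _) (uM0 0%N).
have uM n : rnorm (u_ n) <= M by rewrite (le_trans (uM0 n))// lerDl rnorm_ge0.
have u0M : rnorm u <= M by rewrite lerDr.
have /bounded_operatorsP[C C0 SC] := bS.
have cuS := compact_C_u_alpha cS.
pose bound := 2 * (C * M ^+ 2).
have Qb v z : rnorm v <= M -> 0 <= Normc.normc (Q S v z) <= bound.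
  move=> vM; rewrite modulus_ge0 /=; apply: le_trans (Q_bound v z C0 SC) _.
  rewrite ler_wpM2l// ler_wpM2l// ler_sqr ?nnegrE ?rnorm_ge0//.
  exact: le_trans (rnorm_ge0 _) vM.
apply: (@Lnorm_dominated_cvg R _ _ (@completed_measure_extension _ _ R (mu \x mu)%E)
  Omega p mO p1 (fun n z => Normc.normc (Q S (u_ n) z))
  (fun z => Normc.normc (Q S u z)) bound Ooo).
- by move=> n; exact: measurable_Q.
- by move=> n z; exact: Qb.
- by move=> z; exact: Qb.
move=> z; pose x_ n := tf_unshift z (u_ n); pose x := tf_unshift z u.
have xM n : rnorm (x_ n) <= M by rewrite rnorm_tf_unshift.
have wx v : B (x_ n) v @[n --> \oo] --> B x v.
  by rewrite L2rdot_tf_unshift; under eq_cvg do rewrite L2rdot_tf_unshift; exact: wu.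
have Sx : rnorm (S (x_ n) - S x) @[n --> \oo] --> 0 by exact: compact_weak_to_norm xM wx.
apply/cvgrPdist_le => e e0.
have e2 : 0 < e / (4 * (M + 1)) by rewrite divr_gt0// mulr_gt0// ltr_wpDl// addr_ge0// rnorm_ge0.
have e4 : 0 < e / 4 by rewrite divr_gt0.
have [N1 N1P] := (near_cvg0 _).1 Sx _ e2.
have wx0 v : B (x_ n - x) v @[n --> \oo] --> 0.
  under eq_cvg do rewrite (hilbertBl hB).
  have := cvgB (wx v) (@cvg_cst _ (B x v) _ \oo _).
  by rewrite subrr; exact.
have [N2 N2P] := (near_cvg0 _).1 (wx0 (S x)) _ e4.
have [N3 N3P] := (near_cvg0 _).1 (wx0 ('i *: S x)) _ e4.
exists (maxn N1 (maxn N2 N3)) => // n nN.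
have : (maxn N1 (maxn N2 N3) <= n)%N by exact: nN.
rewrite !geq_max => /and3P[/N1P n1 /N2P n2 /N3P n3].
rewrite distrC; apply: le_trans (normc_dist _ _) _; rewrite !QE -/x -/(x_ n) !L2dotE.
(* The first term is small by norm convergence of [S (x_ n)], the second by weak convergence against
   the fixed vector [S x]; [E2] does the same for the imaginary part. *)
have E1 : B (S (x_ n)) (x_ n) - B (S x) x = B (S (x_ n) - S x) (x_ n) + B (x_ n - x) (S x).
  rewrite (hilbertC hB (x_ n - x)) (hilbertBl hB) (hilbertBr hB).
  by rewrite addrA subrK.
have E2 : B (S (x_ n)) ('i *: x_ n) - B (S x) ('i *: x) =
    B (S (x_ n) - S x) ('i *: x_ n) - B (x_ n - x) ('i *: S x).
  rewrite (hilbertC hB (x_ n - x)) (hilbertIl hB) opprK scalerBr.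
  by rewrite (hilbertBl hB) (hilbertBr hB) addrA subrK.
have SxM (y : H) : rnorm y <= M -> `|B (S (x_ n) - S x) y| <= e / 4.
  move=> yM; apply: le_trans (cauchy_schwarz hB _ _) _.
  have n1' : rnorm (S (x_ n) - S x) <= e / (4 * (M + 1)).
    by apply: le_trans (ltW n1); exact: ler_norm.
  have yM1 : rnorm y <= M + 1 by rewrite (le_trans yM)// lerDl.
  apply: le_trans (ler_pM (rnorm_ge0 _) (rnorm_ge0 _) n1' yM1) _.
  have M1 : M + 1 != 0.
    by rewrite gt_eqF// ltr_wpDl// (le_trans (rnorm_ge0 u)).
  by rewrite invfM mulrA divfK.
have h1 := SxM _ (xM n).
have h2 : `|B (S (x_ n) - S x) ('i *: x_ n)| <= e / 4 by apply: SxM; rewrite rnormI.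
apply: le_trans (normc_le _ _) _; rewrite E1 E2.
apply: le_trans (lerD (ler_normD _ _) (ler_normB _ _)) _.
rewrite (_ : e = (e / 4 + e / 4) + (e / 4 + e / 4)); last by field.
exact: lerD (lerD h1 (ltW n2)) (lerD h2 (ltW n3)).
Qed.

Lemma B_wc_C_u_alpha_compact S (p : R) (Omega : set phase_space) : 1 <= p ->
  phase_measurable Omega -> (0 < phase_measure Omega)%E ->
  (phase_measure Omega < +oo)%E ->
  B_wc p Omega S -> C_u_alpha R d S -> compact_operators H S.
Proof.
move=> p1 mO O0 Ooo [bS wcS] cS.
have p0 : 0 < p by exact: lt_le_trans p1.
have [z0 z0P] := positive_measure_point mO O0.
have /C_u_alphaP[_ ctsS] := cS.
have Q0 : Lp_norm_on p Omega (Q S 0) = 0%E.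
  rewrite /Lp_norm_on (_ : _ \_ Omega = cst 0%E) ?Lnorm0 ?gt_eqF//.
  apply/funext => z; rewrite patchE; case: ifP => // _.
  rewrite -[LHS]/(Normc.normc (Q S 0 z))%:E QE -(scale0r 0) tf_unshiftZ !scale0r.
  rewrite linear0 L2dotE !(hilbert0l hB).
  by congr EFin; exact: Normc.normc0.
(* Near [z0] the function [Q S v] is within [e / 2] of its value at [z0],
   uniformly over bounded [v], so its norm on Omega controls that value. *)
have key (v_ : nat -> H) (M : R) : (forall n, rnorm (v_ n) <= M) ->
    (forall w, B (v_ n) w @[n --> \oo] --> 0) ->
    Normc.normc (Q S (v_ n) z0) @[n --> \oo] --> 0.
  move=> vM wv; apply/near_cvg0 => e e0.
  have wc0 : weakly_converges v_ 0.
    by apply/(weakly_convergesP hB) => w; rewrite (hilbert0l hB).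
  have := wcS _ _ wc0; rewrite Q0 => Lp0.
  have M0 : 0 <= M := le_trans (rnorm_ge0 _) (vM 0%N).
  (* Chosen so that [2 * (e / c) * M ^+ 2 <= e / 2], where the 2 is that of [normc_L2dot]; the [+ 1]
     covers [M = 0]. *)
  pose c := 4 * M ^+ 2 + 1; have c0 : 0 < c by rewrite ltr_wpDl// mulr_ge0// sqr_ge0.
  have [del del0 delP] := ctsS z0 _ (divr_gt0 e0 c0).
  have [A [mA AO A0 Adel]] := z0P del del0.
  have Aoo : (phase_measure A < +oo)%E.
    by apply: le_lt_trans Ooo; apply: le_measure; rewrite ?inE.
  (* The Chebyshev bound below the norm of [Q S (v_ n)] as soon as its modulus is at least [e / 2]
     on [A]. It is positive since [A] is not null, and finite so that it can serve as a real
     threshold. *)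
  pose l := ((((e / 2) `^ p)%:E * phase_measure A) `^ p^-1)%E.
  have l0 : (0 < l)%E.
    by apply: poweR_gt0; apply: mule_gt0 => //; rewrite lte_fin powR_gt0// divr_gt0.
  have l_fin : l \is a fin_num.
    rewrite ge0_fin_numE; last exact: ltW.
    by apply: poweR_lty; rewrite lte_mul_pinfty// lee_fin powR_ge0.
  have fl0 : 0 < fine l by rewrite fine_gt0// l0 ltey_eq l_fin.
  move: Lp0 => /fine_cvgP[[N1 _ N1P] /near_cvg0/(_ _ fl0)[N2 N2P]].
  exists (maxn N1 N2) => n; rewrite geq_max => /andP[nN1 nN2].
  rewrite ger0_norm ?modulus_ge0// ltNge; apply/negP => eQ.
  have e20 : 0 <= e / 2 by rewrite divr_ge0// ltW.
  have half_le z : A z -> e / 2 <= Normc.normc (Q S (v_ n) z).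
    move=> /Adel/delP/(_ (v_ n)) zz0.
    have vv : rnorm (v_ n) * rnorm (v_ n) <= M * M by apply: ler_pM; rewrite ?rnorm_ge0.
    have ec0 : 0 <= e / c by rewrite divr_ge0 ?ltW.
    have dist_le : Normc.normc (Q S (v_ n) z0) - Normc.normc (Q S (v_ n) z) <= e / 2.
      apply: le_trans (ler_norm _) _; rewrite distrC.
      apply: le_trans (normc_dist _ _) _; rewrite /Q -L2dotBl.
      apply: le_trans (normc_L2dot _ _) _.
      have /(ler_wpM2l (ler0n R 2))/le_trans := ler_wpM2r (rnorm_ge0 (v_ n)) zz0; apply.
      have qM := ler_wpM2l ec0 vv.
      have qc : e / c * (4 * M ^+ 2 + 1) = e by rewrite -/c divfK ?gt_eqF.
      move: ec0 qM qc; move: (e / c) (rnorm (v_ n)) => q r; clear.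
      by move=> *; lra.
    by move: dist_le; rewrite lerBlDr => /(le_trans eQ); rewrite {1}[e]splitr lerD2l.
  have : (l <= Lp_norm_on p Omega (Q S (v_ n)))%E.
    exact: (@Lnorm_ge R _ _ (@completed_measure_extension _ _ R (mu \x mu)%E)
      Omega p mO p1 (fun z => Normc.normc (Q S (v_ n) z)) A (e / 2)
      (measurable_Q (v_ n) cS) (fun z => modulus_ge0 (Q S (v_ n) z)) mA AO e20 half_le).
  have Nfin : Lp_norm_on p Omega (Q S (v_ n)) \is a fin_num by exact: N1P.
  rewrite -(fineK l_fin) -(fineK Nfin) lee_fin leNgt => /negP; apply.
  by apply: le_lt_trans (N2P n nN2); exact: ler_norm.
apply: (compact_of_quadratic_form hB) => // u_ M uM wu.
have := key (fun n => tf_shift z0 (u_ n)) M.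
have wPu w : B (tf_shift z0 (u_ n)) w @[n --> \oo] --> 0.
  have E n : B (tf_shift z0 (u_ n)) w = B (u_ n) (tf_unshift z0 w).
    by rewrite -{1}(tf_unshiftK z0 w) L2rdot_tf_shift.
  by under eq_cvg do rewrite E; exact: wu.
move=> /(_ _ wPu)/near_cvg0 Qu.
have {}Qu (e : R) : 0 < e -> exists N, forall n, (N <= n)%N ->
    `|Normc.normc (Q S (tf_shift z0 (u_ n)) z0)| < e.
  by apply: Qu => n; rewrite rnorm_tf_shift.
have Re_le (a b : R) : `|a| <= Normc.normc (a +i* b).
  by rewrite /= -sqrtr_sqr ler_wsqrtr// lerDl sqr_ge0.
have Im_le (a b : R) : `|b| <= Normc.normc (a +i* b).
  by rewrite /= -sqrtr_sqr ler_wsqrtr// lerDr sqr_ge0.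
(* The real and imaginary parts of [L2dot (S (u_ n)) (u_ n)] are the two limits that
   [compact_of_quadratic_form] requires. *)
split; apply/near_cvg0 => e /Qu[N NP]; exists N => n /NP;
  rewrite ger0_norm ?modulus_ge0// QE tf_shiftK L2dotE; apply: le_lt_trans.
  exact: Re_le.
exact: Im_le.
Qed.

End weak_continuity.

Theorem proposition5p6 (R : realType) (d : nat) (d_gt0 : (0 < d)%N)
    (p : R) (p_ge1 : 1 <= p)
    (Omega : set ('rV[R]_d * 'rV[R]_d)%type)
    (mOmega : phase_measurable Omega)
    (Omega_gt0 : (0 < phase_measure Omega)%E)
    (Omega_lty : (phase_measure Omega < +oo)%E) :
  B_wc p Omega `&` C_u_alpha R d = compact_operators (L2 (@lebesgue_rV R d)).
Proof.
apply/seteqP; split=> [S [wcS cS]|S cS].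
  exact: B_wc_C_u_alpha_compact mOmega Omega_gt0 Omega_lty wcS cS.
by split; [exact: compact_B_wc | exact: compact_C_u_alpha].
Qed.
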